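(* Let $C_2=[0,\infty[^2\subset\mathbf{R}^2$ be equipped with the subset diffeology, with coordinates $(x,y)$. Every differential symmetric $2$-tensor $\tau$ on $C_2$ decomposes uniquely as $$\tau=\tau_{\mathrm{reg}}+\frac{A(y)}{x}\,dx^2+\frac{B(x)}{y}\,dy^2,$$ where $\tau_{\mathrm{reg}}$ is the restriction to $C_2$ of a smooth symmetric $2$-tensor on $\mathbf{R}^2$, and $A,B\in C^\infty([0,\infty[)$.
   Context: Subset diffeology: for $X\subset\mathbf{R}^n$, the plots of $X$ are the maps $P\colon U\to X$, with $U$ an open subset of some $\mathbf{R}^m$ ($m\ge 0$ arbitrary), that are smooth as maps into $\mathbf{R}^n$. Differential symmetric $2$-tensor on a diffeological space $X$ (covariant): a map $\tau$ assigning to each plot $P\colon U\to X$ a smooth symmetric covariant $2$-tensor $\tau(P)$ (also written $P^*(\tau)$) on $U$, such that $\tau(P\circ F)=F^*(\tau(P))$ for every smooth $F\colon V\to U$ with $V$ open in a Euclidean space. The space of these tensors is denoted $\mathscr{S}^2(X)$. Restriction: a smooth symmetric $2$-tensor $\sigma$ on $\mathbf{R}^2$ restricts to $C_2$ as the tensor $P\mapsto P^*(\sigma)$, with each plot $P$ of $C_2$ viewed as a smooth map into $\mathbf{R}^2$. Coordinate expressions: $dx^2=dx\otimes dx$ and $dy^2=dy\otimes dy$. The expressions with denominators $x$ and $y$ are coordinate expressions on the interior $]0,\infty[^2$, where $\tau$ is an ordinary smooth symmetric $2$-tensor. $C^\infty([0,\infty[)$ denotes the restrictions to $[0,\infty[$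 of smooth functions on $\mathbf{R}$. *)

(* Defs.v *)
From HB Require Import structures.
From mathcomp Require Import all_boot all_order all_algebra.
From mathcomp Require Import all_classical all_reals all_analysis.

Set Implicit Arguments.
Unset Strict Implicit.
Unset Printing Implicit Defensive.

Import Order.TTheory GRing.Theory Num.Theory.
Import numFieldNormedType.Exports.

Local Open Scope classical_set_scope.
Local Open Scope ring_scope.

(* Maps on a subset [U] of a normed space are represented by total functions;
   their values outside [U] are junk.  For [U] open, the derivatives at the
   points of [U] depend only on the values on [U]. *)

(* [f] is of class C^k on the open set [U].  Meant for [E] finite-dimensional,
   where being C^k.+1 amounts to being differentiable with all directional
   derivatives of class C^k. *)
Fixpoint Ck (R : realType) (E F : normedModType R) (k : nat) (U : set E)
    (f : E -> F) : Prop :=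
  if k is k'.+1
  then (forall x, U x -> differentiable f x) /\
       (forall v : E, Ck k' U (fun x => 'D_v f x))
  else forall x, U x -> {for x, continuous f}.

Definition smooth (R : realType) (E F : normedModType R) (U : set E)
    (f : E -> F) : Prop :=
  forall k : nat, Ck k U f.

(* [T x u v] is the value at the point [x] on the tangent vectors [u], [v]. *)
Definition tensor2 (R : realType) (m : nat) : Type :=
  'rV[R]_m -> 'rV[R]_m -> 'rV[R]_m -> R.

Definition smooth_sym2 (R : realType) (m : nat) (U : set 'rV[R]_m)
    (T : tensor2 R m) : Prop :=
  [/\ forall x u, U x -> scalar (T x u),
      forall x u v, U x -> T x u v = T x v u &
      forall u v, smooth U (fun x => T x u v : R^o)].

Definition pullback (R : realType) (k m : nat) (F : 'rV[R]_k -> 'rV[R]_m)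
    (T : tensor2 R m) : tensor2 R k :=
  fun y u v => T (F y) ('d F y u) ('d F y v).

Definition plot (R : realType) (n : nat) (X : set 'rV[R]_n) (m : nat)
    (U : set 'rV[R]_m) (P : 'rV[R]_m -> 'rV[R]_n) : Prop :=
  [/\ open U, smooth U P & forall x, U x -> X (P x)].

(* A tensor on [U] for each parametrization [P] with domain [U]; only the
   values at plots are meaningful. *)
Definition tensor2_family (R : realType) (n : nat) : Type :=
  forall m : nat, set 'rV[R]_m -> ('rV[R]_m -> 'rV[R]_n) -> tensor2 R m.

(* In [sym2_pullback], [Q] stands for the plot [P \o F] on [V]; asking only for
   equality on [V] makes the value of the family at a plot independent of the
   junk values of the total function representing it. *)
Record sym2_tensor (R : realType) (n : nat) (X : set 'rV[R]_n) := Sym2Tensor {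
  sym2_val : tensor2_family R n;
  sym2_smooth : forall m (U : set 'rV[R]_m) P,
    plot X U P -> smooth_sym2 U (sym2_val U P);
  sym2_pullback : forall m (U : set 'rV[R]_m) P k (V : set 'rV[R]_k) F Q,
    plot X U P -> open V -> smooth V F -> (forall y, V y -> U (F y)) ->
    (forall y, V y -> Q y = P (F y)) ->
    forall y, V y -> forall u v,
      sym2_val V Q y u v = pullback F (sym2_val U P) y u v
}.

Definition restriction (R : realType) (n : nat) (sigma : tensor2 R n) :
    tensor2_family R n :=
  fun m _ P => pullback P sigma.

Definition eq_on_plots (R : realType) (n : nat) (X : set 'rV[R]_n)
    (t1 t2 : tensor2_family R n) : Prop :=
  forall m (U : set 'rV[R]_m) P, plot X U P ->
  forall x, U x -> forall u v, t1 m U P x u v = t2 m U P x u v.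

Definition xcoord (R : realType) (p : 'rV[R]_2) : R := p 0 0.
Definition ycoord (R : realType) (p : 'rV[R]_2) : R := p 0 1.

Definition C2 (R : realType) : set 'rV[R]_2 :=
  [set p | 0 <= xcoord p /\ 0 <= ycoord p].

Definition C2int (R : realType) : set 'rV[R]_2 :=
  [set p | 0 < xcoord p /\ 0 < ycoord p].

(* The functions dx and dy on tangent vectors are the coordinates themselves. *)
Definition dx2 (R : realType) (u v : 'rV[R]_2) : R := xcoord u * xcoord v.
Definition dy2 (R : realType) (u v : 'rV[R]_2) : R := ycoord u * ycoord v.

(* C^oo([0, +oo[): only the values of [A] on [0, +oo[ matter. *)
Definition smooth_half_line (R : realType) (A : R -> R) : Prop :=
  exists2 f : R^o -> R^o, smooth setT f & forall t, 0 <= t -> A t = f t.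

(* tau = sigma|_{C2} + A(y)/x dx^2 + B(x)/y dy^2, as an identity between the
   tensors that both sides define on the open set ]0, +oo[^2, i.e. between their
   values at the plot given by the inclusion of that set. *)
Definition decomposition (R : realType) (tau : sym2_tensor (C2 (R:=R)))
    (sigma : tensor2 R 2) (A B : R -> R) : Prop :=
  [/\ smooth_sym2 setT sigma, smooth_half_line A, smooth_half_line B &
      forall p, C2int p -> forall u v,
        sym2_val tau (C2int (R:=R)) id p u v =
          restriction sigma (C2int (R:=R)) id p u v
          + A (ycoord p) / xcoord p * dx2 u v
          + B (xcoord p) / ycoord p * dy2 u v].

(* Main.v *)
(* Pull [tau] back by the plot [(s, t) |-> (s^2, t^2)] and write the result as
   [a ds^2 + 2 b ds dt + c dt^2].  This plot is invariant under [s |-> -s] and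
   [t |-> -t], so [a] and [c] are even in both variables and [b] is odd in both.
   By Whitney's theorem on even functions, [a = a'(s^2, t^2)],
   [b = s t b'(s^2, t^2)] and [c = c'(s^2, t^2)] with [a'], [b'], [c'] smooth on
   the whole plane.  Since [dx = 2 s ds] and [dy = 2 t dt], on the open quadrant
   [tau = a' / (4 x) dx^2 + b' / 2 dx dy + c' / (4 y) dy^2], and writing
   [a' = a'(0, y) + x * _] and [c' = c'(x, 0) + y * _] gives the decomposition,
   with [A = a'(0, _) / 4] and [B = c'(_, 0) / 4].  Uniqueness follows by
   multiplying by [x] (or [y]), letting it tend to [0], and by density.

   Whitney's theorem is obtained with Seeley's reflection: for [x < 0] the
   extension of [h x = f (sqrt x)] is a series [sum_k a_k h (rho_k x)] where
   [sum_k a_k 4^(k n) = (-1)^n] for all [n].  The arguments [rho_k] stay in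
   [0, 1], so no cut-off function is needed. *)

Require Import Defs.
From HB Require Import structures.
From mathcomp Require Import all_boot all_order all_algebra.
From mathcomp Require Import ring lra.
From mathcomp Require Import all_classical all_reals all_analysis.
Import Order.TTheory GRing.Theory Num.Theory.
Import numFieldNormedType.Exports.
Set Implicit Arguments.
Unset Strict Implicit.
Unset Printing Implicit Defensive.
Local Open Scope classical_set_scope.
Local Open Scope ring_scope.

(** The series is an ordinary Seeley reflection in the coordinate xi = w / (1 - w), which maps [0,
    1[ onto [0, +oo[: [rho k z] is the point with xi = 4^k z, and [zeta x] is - xi for x <= 0.
    Derivatives are therefore computed in xi, where d/dxi = (1 - w)^2 d/dw.

    The obstacle is to find a family of functions closed under differentiation. If f is even in s,
    then df/ds is odd, hence of the form 2 s g with g smooth and even by Hadamard's lemma, and g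
    represents the derivative of f (sqrt w) in w = s^2. On the reflected side each derivative in xi
    also brings out a factor 4^k, so the family has to contain the series weighted by 4^(k m) for
    every m. The a_k decay fast enough for all of these to converge, and the moments (-1)^m make
    each of them meet the right-hand branch at 0. All candidate derivatives are thus continuous
    across 0, and the mean value theorem turns this into differentiability there. The second
    variable is carried along as a parameter, so that the argument can be applied in each variable
    in turn. *)

(** * One-variable calculus *)

Section Calculus1.
Variable R : realType.
Implicit Types (f df : R -> R) (a b x d : R).

(** Clearing the denominator makes [h = 0] harmless, so later estimates need no punctured
    neighbourhoods. *)
Lemma is_derive_epsP f x d :
  is_derive x 1 f d <->
  forall e : R, 0 < e -> exists2 r : R, 0 < r &
    forall h, `|h| < r -> `|f (x + h) - f x - h * d| <= e * `|h|.
Proof.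
split=> [[df dE] e e0|H].
  have : h^-1 *: ((f \o shift x) (h *: 1) - f x) @[h --> 0^'] --> d.
    by rewrite -dE; exact: df.
  move=> /cvgrPdist_lt/(_ e e0); move=> /nbhs_ballP[r /= r0 hr].
  exists r => // h hr'; have [->|h0] := eqVneq h 0.
    by rewrite addr0 subrr mul0r subrr !normr0 mulr0.
  have hb : ball (0 : R) r h by rewrite /ball /= sub0r normrN.
  have := hr h hb h0.
  rewrite /= /GRing.scale /= mulr1 [h + x]addrC => hle.
  have -> : f (x + h) - f x - h * d = - (d - h^-1 * (f (x + h) - f x)) * h.
    by field.
  by rewrite normrM normrN ler_wpM2r// ltW.
have : h^-1 *: ((f \o shift x) (h *: 1) - f x) @[h --> 0^'] --> d.
  apply/cvgrPdist_le => e e0; have [r r0 hr] := H e e0.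
  near=> h.
  have h0 : h != 0 by near: h; exact: nbhs_dnbhs_neq.
  have hh : `|h| < r.
    near: h; apply/nbhs_ballP; exists r => //= y.
    by rewrite /ball /= sub0r normrN.
  have := hr h hh; rewrite /= /GRing.scale /= mulr1 [h + x]addrC => hle.
  have -> : d - h^-1 * (f (x + h) - f x) = - (f (x + h) - f x - h * d) / h.
    by field.
  by rewrite normrM normrN normfV ler_pdivrMr// normr_gt0.
by move=> cvd; split; [apply/cvg_ex; exists d|exact: cvg_lim].
Unshelve. all: by end_near. Qed.

Lemma cont1P f x :
  {for x, continuous f} <->
  forall e : R, 0 < e -> exists2 r : R, 0 < r &
    forall y, `|y - x| < r -> `|f y - f x| <= e.
Proof.
split=> [/cvgrPdist_le cf e e0|H].
  have /nbhs_ballP[r /= r0 hr] := cf e e0.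
  exists r => // y yx; rewrite distrC; apply: hr => /=.
  by rewrite /ball /= distrC.
apply/cvgrPdist_le => e e0; have [r r0 hr] := H e e0.
apply/nbhs_ballP; exists r => //= y yx; rewrite distrC; apply: hr.
by rewrite distrC.
Qed.

Lemma is_derive_cont f x d : is_derive x 1 f d -> {for x, continuous f}.
Proof.
by move=> df; apply: differentiable_continuous; apply/derivable1_diffP; case: df.
Qed.

(** The endpoints come in either order because the increments used below have either sign. *)
Lemma mvt_between f df a b :
  (forall x, Num.min a b <= x <= Num.max a b -> {for x, continuous f}) ->
  (forall x, Num.min a b < x < Num.max a b -> is_derive x 1 f (df x)) ->
  a != b -> exists2 c, Num.min a b < c < Num.max a b & f b - f a = df c * (b - a).
Proof.
move=> cf dfx.
have H u v : u < v -> (forall x, u <= x <= v -> {for x, continuous f}) ->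
    (forall x, u < x < v -> is_derive x 1 f (df x)) ->
    exists2 c, u < c < v & f v - f u = df c * (v - u).
  move=> uv cf' df'.
  have [c cuv ->] : exists2 c, c \in `]u, v[ & f v - f u = df c * (v - u).
    apply: MVT => //.
    apply: continuous_in_subspaceT => x; rewrite inE /= in_itv /=; exact: cf'.
  by exists c => //; rewrite in_itv /= in cuv.
case: (ltgtP a b) cf dfx => [ab|ba|] // cf dfx _.
  exact: H.
have [c ? E] := H _ _ ba cf dfx; exists c => //.
by rewrite -opprB E -mulrN opprB.
Qed.

Lemma mvt_btw f df a b :
  (forall x, Num.min a b <= x <= Num.max a b -> is_derive x 1 f (df x)) ->
  exists2 c, Num.min a b <= c <= Num.max a b & f b - f a = df c * (b - a).
Proof.
move=> dfx; have [->|ab] := eqVneq a b.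
  by exists b; rewrite ?subrr ?mulr0// minxx maxxx lexx.
have [] := @mvt_between f df a b _ _ ab.
- by move=> x /dfx /is_derive_cont.
- by move=> x /andP[h1 h2]; apply: dfx; rewrite !ltW.
- by move=> c /andP[h1 h2] E; exists c => //; rewrite !ltW.
Qed.

Lemma btw_dist a b x : Num.min a b <= x <= Num.max a b -> `|x - a| <= `|b - a|.
Proof.
case: (leP a b) => ab /andP[h1 h2].
  by rewrite !ger0_norm ?subr_ge0// lerD2r.
by rewrite !ler0_norm ?subr_le0 ?(ltW ab)// lerN2 lerD2r.
Qed.

Lemma btw_trans a b c x : Num.min a b <= c <= Num.max a b ->
  Num.min a c <= x <= Num.max a c -> Num.min a b <= x <= Num.max a b.
Proof. by case: (leP a b) => ?; case: (leP a c) => ?; lra. Qed.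

(** Two mean values, hence [M] instead of [M / 2]. The point is that [M] can be tracked through all
    the terms of a series. *)
Lemma taylor2_bound f df ddf a b (M : R) :
  (forall x, Num.min a b <= x <= Num.max a b -> is_derive x 1 f (df x)) ->
  (forall x, Num.min a b <= x <= Num.max a b -> is_derive x 1 df (ddf x)) ->
  (forall x, Num.min a b <= x <= Num.max a b -> `|ddf x| <= M) ->
  `|f b - f a - (b - a) * df a| <= M * (b - a) ^+ 2.
Proof.
move=> fd dd dM.
have [c cab E] := mvt_btw fd.
have [e ecab E'] : exists2 e, Num.min a c <= e <= Num.max a c & df c - df a = ddf e * (c - a).
  by apply: mvt_btw => x xac; apply: dd; exact: btw_trans xac.
have -> : f b - f a - (b - a) * df a = (ddf e * (c - a)) * (b - a).
  by rewrite E -E'; ring.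
rewrite !normrM -real_normK ?num_real// expr2 mulrA ler_wpM2r// ler_pM//.
  by apply: dM; exact: btw_trans ecab.
exact: btw_dist.
Qed.

(** A quadratic remainder survives summation, so termwise Taylor bounds suffice to differentiate a
    series. *)
Lemma is_derive_quad f x d (M r : R) : 0 < r ->
  (forall h, `|h| < r -> `|f (x + h) - f x - h * d| <= M * h ^+ 2) ->
  is_derive x 1 f d.
Proof.
move=> r0 H; apply/is_derive_epsP => e e0.
have M0 : 0 < `|M| + 1 by rewrite ltr_wpDl.
exists (Num.min r (e / (`|M| + 1))).
  by rewrite lt_min r0 divr_gt0.
move=> h; rewrite lt_min => /andP[hr he].
apply: le_trans (H h hr) _; rewrite -real_normK ?num_real// expr2 mulrA.
apply: ler_wpM2r => //; apply: le_trans (_ : (`|M| + 1) * `|h| <= _).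
  by apply: ler_wpM2r => //; rewrite (le_trans (ler_norm _))// lerDl.
by rewrite mulrC -ler_pdivlMr// ltW.
Qed.

(** The difference quotient at [a] is a value of [df] near [a], by the mean value theorem. This
    supplies the derivative at a removable singularity and at the junction of two branches. *)
Lemma is_derive_limit f df a :
  {for a, continuous f} -> {for a, continuous df} ->
  (exists2 r : R, 0 < r &
     forall x, `|x - a| < r -> x != a -> is_derive x 1 f (df x)) ->
  is_derive a 1 f (df a).
Proof.
move=> cf /cont1P cdf [r r0 H]; apply/is_derive_epsP => e e0.
have [r' r'0 H'] := cdf e e0.
exists (Num.min r r'); first by rewrite lt_min r0.
move=> h; rewrite lt_min => /andP[hr hr'].
have [->|h0] := eqVneq h 0.
  by rewrite addr0 subrr mul0r subrr !normr0 mulr0.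
have near_a x : Num.min a (a + h) <= x <= Num.max a (a + h) -> `|x - a| <= `|h|.
  by move=> /btw_dist; rewrite [a + h]addrC addrK.
have [] := @mvt_between f df a (a + h).
- move=> x xab; have [->//|xa] := eqVneq x a.
  apply: is_derive_cont; apply: H => //.
  by apply: le_lt_trans hr; exact: near_a.
- move=> x /andP[h1 h2]; apply: H.
    by apply: le_lt_trans hr; apply: near_a; rewrite !ltW.
  by move: h1 h2; case: (ltP a (a + h)) => ? h1 h2; lra.
- by rewrite -subr_eq0 opprD addNKr oppr_eq0.
- move=> c /andP[h1 h2] ->; have -> : a + h - a = h by ring.
  have -> : df c * h - h * df a = (df c - df a) * h by ring.
  rewrite normrM ler_wpM2r//; apply: H'.
  by apply: le_lt_trans hr'; apply: near_a; rewrite !ltW.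
Qed.

End Calculus1.

(** * Functions of class C^k of two variables *)

HB.lock Definition pd1 (R : realType) (f : R -> R -> R) : R -> R -> R :=
  fun x y => 'D_1 (f^~ y) x.
HB.lock Definition pd2 (R : realType) (f : R -> R -> R) : R -> R -> R :=
  fun x y => 'D_1 (f x) y.

Section Calculus2.
Variable R : realType.
Implicit Types (f g : R -> R -> R) (U V : set (R * R)) (k : nat) (x y : R).

Variant cont2 f x y : Prop :=
  Cont2 of {for (x, y), continuous (fun q : R * R => f q.1 q.2)}.

(* An inductive family rather than a fixpoint, so that unification never
   unfolds it. *)
Inductive Cn U : nat -> (R -> R -> R) -> Prop :=
| Cn_O f : (forall x y, U (x, y) -> cont2 f x y) -> Cn U 0 f
| Cn_S k f : (forall x y, U (x, y) -> cont2 f x y) ->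
    (forall x y, U (x, y) -> derivable (f^~ y) x 1 /\ derivable (f x) y 1) ->
    Cn U k (pd1 f) -> Cn U k (pd2 f) -> Cn U k.+1 f.

Definition sm U f : Prop := forall k, Cn U k f.

Lemma pd1E f x y : pd1 f x y = 'D_1 (f^~ y) x.
Proof. by rewrite pd1.unlock. Qed.

Lemma pd2E f x y : pd2 f x y = 'D_1 (f x) y.
Proof. by rewrite pd2.unlock. Qed.

Lemma cont2P f x y :
  cont2 f x y <->
  forall e : R, 0 < e -> exists2 r : R, 0 < r &
    forall x' y', `|x' - x| < r -> `|y' - y| < r -> `|f x' y' - f x y| <= e.
Proof.
split=> [[/cvgrPdist_le cf] e e0|H].
  have /nbhs_ballP[r /= r0 hr] := cf e e0.
  exists r => // x' y' xx' yy'; rewrite distrC.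
  apply: (hr (x', y')); split; by rewrite /ball /= distrC.
split; apply/cvgrPdist_le => e e0; have [r r0 hr] := H e e0.
apply/(@nbhs_ballP R (R * R)%type); exists r => //= -[x' y'] [/= xx' yy']; rewrite distrC.
by apply: hr; rewrite distrC.
Qed.

Lemma openP2 U x y : open U -> U (x, y) ->
  exists2 r : R, 0 < r &
    forall x' y', `|x' - x| < r -> `|y' - y| < r -> U (x', y').
Proof.
move=> oU Uxy.
have /nbhs_ballP[r /= r0 hr] : nbhs (x, y) U by apply: open_nbhs_nbhs; split.
exists r => // x' y' xx' yy'.
apply: (hr (x', y')); split; by rewrite /ball /= distrC.
Qed.

Lemma near_open1 U x y (P : R -> Prop) : open U -> U (x, y) ->
  (forall x', U (x', y) -> P x') -> \forall x' \near x, P x'.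
Proof.
move=> oU Uxy H; have [r r0 hr] := openP2 oU Uxy.
apply/nbhs_ballP; exists r => //= x' xx'; apply/H/hr.
  by rewrite distrC.
by rewrite subrr normr0.
Qed.

Lemma near_open2 U x y (P : R -> Prop) : open U -> U (x, y) ->
  (forall y', U (x, y') -> P y') -> \forall y' \near y, P y'.
Proof.
move=> oU Uxy H; have [r r0 hr] := openP2 oU Uxy.
apply/nbhs_ballP; exists r => //= y' yy'; apply/H/hr.
  by rewrite subrr normr0.
by rewrite distrC.
Qed.

Lemma cont2_1 f x y : cont2 f x y -> {for x, continuous (f^~ y)}.
Proof.
move=> /cont2P H; apply/cont1P => e e0; have [r r0 hr] := H e e0.
by exists r => // x' xx'; apply: hr => //; rewrite subrr normr0.
Qed.

Lemma cont2_2 f x y : cont2 f x y -> {for y, continuous (f x)}.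
Proof.
move=> /cont2P H; apply/cont1P => e e0; have [r r0 hr] := H e e0.
by exists r => // y' yy'; apply: hr => //; rewrite subrr normr0.
Qed.

Lemma cont2D f g x y : cont2 f x y -> cont2 g x y ->
  cont2 (fun x y => f x y + g x y) x y.
Proof. by move=> [cf] [cg]; split; apply: cvgD. Qed.

Lemma cont2M f g x y : cont2 f x y -> cont2 g x y ->
  cont2 (fun x y => f x y * g x y) x y.
Proof. by move=> [cf] [cg]; split; apply: cvgM. Qed.

Lemma CnSP k U f : Cn U k.+1 f ->
  [/\ forall x y, U (x, y) -> cont2 f x y,
      forall x y, U (x, y) -> derivable (f^~ y) x 1 /\ derivable (f x) y 1,
      Cn U k (pd1 f) & Cn U k (pd2 f)].
Proof.
move=> H; inversion H as [|k' f' cf dd c1 c2].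
by split; [exact: cf|exact: dd|exact: c1|exact: c2].
Qed.

Lemma Cn_cont k U f x y : Cn U k f -> U (x, y) -> cont2 f x y.
Proof. by case=> [g H|k' g H _ _ _]; exact: H. Qed.

Lemma Cn_is_derive1 k U f x y : Cn U k.+1 f -> U (x, y) ->
  is_derive x 1 (f^~ y) (pd1 f x y).
Proof. by move=> /CnSP[_ H _ _] /H[D _]; rewrite pd1E; exact: derivableP D. Qed.

Lemma Cn_is_derive2 k U f x y : Cn U k.+1 f -> U (x, y) ->
  is_derive y 1 (f x) (pd2 f x y).
Proof. by move=> /CnSP[_ H _ _] /H[_ D]; rewrite pd2E; exact: derivableP D. Qed.

Lemma Cn_pd1 k U f : Cn U k.+1 f -> Cn U k (pd1 f).
Proof. by case/CnSP. Qed.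

Lemma Cn_pd2 k U f : Cn U k.+1 f -> Cn U k (pd2 f).
Proof. by case/CnSP. Qed.

Lemma Cn_eq k U f g : open U -> (forall x y, U (x, y) -> f x y = g x y) ->
  Cn U k f -> Cn U k g.
Proof.
move=> oU; have ceq f' g' : (forall x y, U (x, y) -> f' x y = g' x y) ->
    (forall x y, U (x, y) -> cont2 f' x y) -> forall x y, U (x, y) -> cont2 g' x y.
  move=> fg cf x y Uxy; have [r r0 hr] := openP2 oU Uxy.
  apply/cont2P => e e0; have /cont2P/(_ e e0)[r' r'0 hr'] := cf _ _ Uxy.
  exists (Num.min r r'); first by rewrite lt_min r0.
  move=> x' y'; rewrite !lt_min => /andP[? ?] /andP[? ?].
  by rewrite -!fg//; [exact: hr'|exact: hr].
elim: k f g => [|k IH] f g fg hf.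
  by apply: Cn_O; apply: ceq fg _ => x y; exact: Cn_cont hf.
have [cf dd c1 c2] := CnSP hf.
have D1 x y : U (x, y) -> is_derive x 1 (g^~ y) (pd1 f x y).
  move=> Uxy; apply: near_eq_is_derive (Cn_is_derive1 hf Uxy).
  by apply: near_open1 oU Uxy _ => x' /fg.
have D2 x y : U (x, y) -> is_derive y 1 (g x) (pd2 f x y).
  move=> Uxy; apply: near_eq_is_derive (Cn_is_derive2 hf Uxy).
  by apply: near_open2 oU Uxy _ => y' /fg.
apply: Cn_S; first exact: ceq fg cf.
- by move=> x y Uxy; split; [case: (D1 _ _ Uxy)|case: (D2 _ _ Uxy)].
- by apply: IH c1 => x y Uxy; rewrite [RHS]pd1E; case: (D1 _ _ Uxy).
- by apply: IH c2 => x y Uxy; rewrite [RHS]pd2E; case: (D2 _ _ Uxy).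
Qed.

(** The form used in the smoothness inductions: candidates for the two partial derivatives are
    exhibited within the family covered by the induction hypothesis. *)
Lemma CnS k U f f1 f2 : open U ->
  (forall x y, U (x, y) -> cont2 f x y) ->
  (forall x y, U (x, y) -> is_derive x 1 (f^~ y) (f1 x y)) ->
  (forall x y, U (x, y) -> is_derive y 1 (f x) (f2 x y)) ->
  Cn U k f1 -> Cn U k f2 -> Cn U k.+1 f.
Proof.
move=> oU cf d1 d2 c1 c2; apply: Cn_S => //.
- by move=> x y Uxy; split; [case: (d1 _ _ Uxy)|case: (d2 _ _ Uxy)].
- by apply: Cn_eq oU _ c1 => x y Uxy; rewrite pd1E; case: (d1 _ _ Uxy).
- by apply: Cn_eq oU _ c2 => x y Uxy; rewrite pd2E; case: (d2 _ _ Uxy).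
Qed.

Lemma CnW k U f : Cn U k.+1 f -> Cn U k f.
Proof.
elim: k f => [|k IH] f /CnSP[cf dd c1 c2]; first exact: Cn_O.
by apply: Cn_S => //; exact: IH.
Qed.

Lemma Cn_sub k U V f : U `<=` V -> Cn V k f -> Cn U k f.
Proof.
move=> UV; elim: k f => [|k IH] f hf.
  by apply: Cn_O => x y /UV; exact: Cn_cont hf.
have [cf dd c1 c2] := CnSP hf; apply: Cn_S; [|by move=> x y /UV /dd|exact: IH|exact: IH].
by move=> x y /UV /cf.
Qed.

Lemma CnU k U V f : Cn U k f -> Cn V k f -> Cn (U `|` V) k f.
Proof.
elim: k f => [|k IH] f hf hf'.
  by apply: Cn_O => x y [/(Cn_cont hf)|/(Cn_cont hf')].
have [cf dd c1 c2] := CnSP hf; have [cf' dd' c1' c2'] := CnSP hf'.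
apply: Cn_S; [|by move=> x y [/dd|/dd']|exact: IH|exact: IH].
by move=> x y [/cf|/cf'].
Qed.

Lemma Cn_cst k U c : open U -> Cn U k (fun _ _ => c).
Proof.
move=> oU; have cc a x y : cont2 (fun _ _ => a) x y by split; exact: cvg_cst.
elim: k c => [|k IH] c; first by apply: Cn_O => x y _; exact: cc.
apply: (CnS oU _ _ _ (IH 0) (IH 0)) => x y _; first exact: cc.
exact: is_derive_cst.
Qed.

Lemma Cn_fst k U : open U -> Cn U k (fun x _ => x).
Proof.
move=> oU; have c x y : cont2 (fun x _ => x) x y by split; exact: cvg_fst.
case: k => [|k]; first by apply: Cn_O => x y _; exact: c.
apply: (CnS oU _ _ _ (Cn_cst k 1 oU) (Cn_cst k 0 oU)) => x y _.
exact: c.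
Qed.

Lemma cont2_swap f x y : cont2 f x y -> cont2 (fun y x => f x y) y x.
Proof.
move=> /cont2P cc; apply/cont2P => e /cc[r r0 hr].
by exists r => // x' y' xx' yy'; exact: hr.
Qed.

Lemma Cn_swap k U f : Cn U k f -> Cn [set q | U (q.2, q.1)] k (fun y x => f x y).
Proof.
elim: k f => [|k IH] f hf.
  by apply: Cn_O => y x /= /(Cn_cont hf)/cont2_swap.
have [cf dd c1 c2] := CnSP hf; apply: Cn_S.
- by move=> y x /= /cf/cont2_swap.
- by move=> y x /= /dd[d1 d2]; split; [exact: d2|exact: d1].
- have -> : pd1 (fun y x => f x y) = (fun y x => pd2 f x y).
    by apply/funext => y; apply/funext => x; rewrite pd1E pd2E.
  exact: IH c2.
- have -> : pd2 (fun y x => f x y) = (fun y x => pd1 f x y).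
    by apply/funext => y; apply/funext => x; rewrite pd1E pd2E.
  exact: IH c1.
Qed.

Lemma Cn_snd k U : open U -> Cn U k (fun _ y => y).
Proof.
by move=> oU; exact: (Cn_sub (@subsetT _ _) (Cn_swap (Cn_fst k openT))).
Qed.

Lemma CnD k U f g : open U -> Cn U k f -> Cn U k g ->
  Cn U k (fun x y => f x y + g x y).
Proof.
move=> oU; elim: k f g => [|k IH] f g hf hg.
  by apply: Cn_O => x y Uxy; exact: cont2D (Cn_cont hf Uxy) (Cn_cont hg Uxy).
apply: (@CnS _ _ _ (fun x y => pd1 f x y + pd1 g x y)
   (fun x y => pd2 f x y + pd2 g x y)) => //.
- by move=> x y Uxy; exact: cont2D (Cn_cont hf Uxy) (Cn_cont hg Uxy).
- by move=> x y Uxy; exact: is_deriveD (Cn_is_derive1 hf Uxy) (Cn_is_derive1 hg Uxy).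
- by move=> x y Uxy; exact: is_deriveD (Cn_is_derive2 hf Uxy) (Cn_is_derive2 hg Uxy).
- exact: IH (Cn_pd1 hf) (Cn_pd1 hg).
- exact: IH (Cn_pd2 hf) (Cn_pd2 hg).
Qed.

Lemma CnM k U f g : open U -> Cn U k f -> Cn U k g ->
  Cn U k (fun x y => f x y * g x y).
Proof.
move=> oU; elim: k f g => [|k IH] f g hf hg.
  by apply: Cn_O => x y Uxy; exact: cont2M (Cn_cont hf Uxy) (Cn_cont hg Uxy).
have [hf' hg'] := (CnW hf, CnW hg).
apply: (@CnS _ _ _ (fun x y => f x y * pd1 g x y + g x y * pd1 f x y)
   (fun x y => f x y * pd2 g x y + g x y * pd2 f x y)) => //.
- by move=> x y Uxy; exact: cont2M (Cn_cont hf Uxy) (Cn_cont hg Uxy).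
- by move=> x y Uxy; exact: is_deriveM (Cn_is_derive1 hf Uxy) (Cn_is_derive1 hg Uxy).
- by move=> x y Uxy; exact: is_deriveM (Cn_is_derive2 hf Uxy) (Cn_is_derive2 hg Uxy).
- exact: CnD oU (IH _ _ hf' (Cn_pd1 hg)) (IH _ _ hg' (Cn_pd1 hf)).
- exact: CnD oU (IH _ _ hf' (Cn_pd2 hg)) (IH _ _ hg' (Cn_pd2 hf)).
Qed.

(* Both mixed derivatives are limits of the same second difference quotient. *)
Lemma schwarz U f x y : open U -> Cn U 2 f -> U (x, y) ->
  pd2 (pd1 f) x y = pd1 (pd2 f) x y.
Proof.
move=> oU cf Uxy; have [r r0 hr] := openP2 oU Uxy.
apply/eqP; rewrite -subr_eq0 -normr_le0; apply/ler_addgt0Pr => e e0; rewrite add0r.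
have /cont2P/(_ (e / 2))[|r1 r10 h1] := Cn_cont (Cn_pd2 (Cn_pd1 cf)) Uxy.
  by rewrite divr_gt0.
have /cont2P/(_ (e / 2))[|r2 r20 h2] := Cn_cont (Cn_pd1 (Cn_pd2 cf)) Uxy.
  by rewrite divr_gt0.
have [h [h0 hr' hr1 hr2]] : exists h, [/\ 0 < h, h < r, h < r1 & h < r2].
  exists (Num.min r (Num.min r1 r2) / 2); set m := Num.min r _.
  have m0 : 0 < m by rewrite !lt_min r0 r10.
  have mh : m / 2 < m by lra.
  have : m <= m by []; rewrite {2}/m !le_min => /andP[? /andP[? ?]].
  by split; lra.
have in_h a b : b <= a <= b + h -> `|a - b| < r /\ `|a - b| < r1 /\ `|a - b| < r2.
  by move=> ?; rewrite ger0_norm; lra.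
have minE a : Num.min a (a + h) = a by apply/min_idPl; lra.
have maxE a : Num.max a (a + h) = a + h by apply/max_idPr; lra.
have UU x' y' : x <= x' <= x + h -> y <= y' <= y + h -> U (x', y').
  by move=> /in_h[? _] /in_h[? _]; exact: hr.
have yh1 : y <= y <= y + h by lra.
have yh2 : y <= y + h <= y + h by lra.
have xh1 : x <= x <= x + h by lra.
have xh2 : x <= x + h <= x + h by lra.
have [|c1] := @mvt_btw _ (fun t => f t (y + h) - f t y)
    (fun t => pd1 f t (y + h) - pd1 f t y) x (x + h).
  move=> t; rewrite minE maxE => xt.
  by apply: is_deriveB; apply: Cn_is_derive1 cf _; exact: UU.
rewrite minE maxE => xc1 E1.
have [|d1] := @mvt_btw _ (pd1 f c1) (pd2 (pd1 f) c1) y (y + h).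
  move=> t; rewrite minE maxE => yt.
  by apply: Cn_is_derive2 (Cn_pd1 cf) _; exact: UU.
rewrite minE maxE => yd1 E1'.
have [|d2] := @mvt_btw _ (fun t => f (x + h) t - f x t)
    (fun t => pd2 f (x + h) t - pd2 f x t) y (y + h).
  move=> t; rewrite minE maxE => yt.
  by apply: is_deriveB; apply: Cn_is_derive2 cf _; exact: UU.
rewrite minE maxE => yd2 E2.
have [|c2] := @mvt_btw _ (fun t => pd2 f t d2) (fun t => pd1 (pd2 f) t d2) x (x + h).
  move=> t; rewrite minE maxE => xt.
  by apply: Cn_is_derive1 (Cn_pd2 cf) _; exact: UU.
rewrite minE maxE => xc2 E2'.
have E : pd2 (pd1 f) c1 d1 = pd1 (pd2 f) c2 d2.
  have hh : h * h != 0 by rewrite mulf_neq0// gt_eqF.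
  apply: (mulIf hh).
  move: E1 E2; rewrite E1' E2' => E1 E2.
  have -> : pd2 (pd1 f) c1 d1 * (h * h) =
    pd2 (pd1 f) c1 d1 * (y + h - y) * (x + h - x) by ring.
  have -> : pd1 (pd2 f) c2 d2 * (h * h) =
    pd1 (pd2 f) c2 d2 * (x + h - x) * (y + h - y) by ring.
  by rewrite -E1 -E2; ring.
have [_ [xc1r1 _]] := in_h _ _ xc1; have [_ [yd1r1 _]] := in_h _ _ yd1.
have [_ [_ xc2r2]] := in_h _ _ xc2; have [_ [_ yd2r2]] := in_h _ _ yd2.
have := h1 _ _ xc1r1 yd1r1; have := h2 _ _ xc2r2 yd2r2; rewrite E !ler_norml.
by move=> ? ?; apply/andP; split; lra.
Qed.

End Calculus2.

(** * Hadamard's lemma *)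

Section Hadamard.
Variable R : realType.
Implicit Types (f : R -> R -> R) (U : set (R * R)) (k n : nat) (x y s t : R).

Lemma CnV k U f : open U -> (forall x y, U (x, y) -> f x y != 0) ->
  Cn U k f -> Cn U k (fun x y => (f x y)^-1).
Proof.
move=> oU f0; have cV g x y : g x y != 0 -> cont2 g x y ->
    cont2 (fun x y => (g x y)^-1) x y.
  by move=> g0 [cg]; split; exact: cvgV.
elim: k => [|k IH] hf.
  by apply: Cn_O => x y Uxy; exact: cV (f0 _ _ Uxy) (Cn_cont hf Uxy).
have hV := IH (CnW hf); have hVV := CnM oU hV hV.
have hm := CnM oU (Cn_cst k (-1) oU) hVV.
have d1 x y : U (x, y) -> is_derive x 1 (fun x => (f x y)^-1)
    (-1 * ((f x y)^-1 * (f x y)^-1) * pd1 f x y).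
  move=> Uxy; have := @is_deriveV R (f^~ y) x _ _ (f0 _ _ Uxy) (Cn_is_derive1 hf Uxy).
  by move/is_derive_eq; apply; rewrite /GRing.scale /=; field; exact: f0.
have d2 x y : U (x, y) -> is_derive y 1 (fun y => (f x y)^-1)
    (-1 * ((f x y)^-1 * (f x y)^-1) * pd2 f x y).
  move=> Uxy; have := @is_deriveV R (f x) y _ _ (f0 _ _ Uxy) (Cn_is_derive2 hf Uxy).
  by move/is_derive_eq; apply; rewrite /GRing.scale /=; field; exact: f0.
apply: (CnS oU _ d1 d2 (CnM oU hm (Cn_pd1 hf)) (CnM oU hm (Cn_pd2 hf))).
by move=> x y Uxy; exact: cV (f0 _ _ Uxy) (Cn_cont hf Uxy).
Qed.

Lemma sm_pd1 U f : sm U f -> sm U (pd1 f).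
Proof. by move=> h k; exact: Cn_pd1 (h k.+1). Qed.

Lemma sm_pd2 U f : sm U f -> sm U (pd2 f).
Proof. by move=> h k; exact: Cn_pd2 (h k.+1). Qed.

Lemma smD U f g : open U -> sm U f -> sm U g -> sm U (fun x y => f x y + g x y).
Proof. by move=> oU hf hg k; exact: CnD. Qed.

Lemma smM U f g : open U -> sm U f -> sm U g -> sm U (fun x y => f x y * g x y).
Proof. by move=> oU hf hg k; exact: CnM. Qed.

Lemma sm_cst U c : open U -> sm U (fun _ _ : R => c : R).
Proof. by move=> oU k; exact: Cn_cst. Qed.

Lemma sm_fst U : open U -> sm U (fun x _ : R => x).
Proof. by move=> oU k; exact: Cn_fst. Qed.

Lemma sm_snd U : open U -> sm U (fun _ y : R => y).
Proof. by move=> oU k; exact: Cn_snd. Qed.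

Lemma sm_fstX n : sm setT (fun x _ : R => x ^+ n).
Proof.
elim: n => [|n IH]; first exact: sm_cst openT.
move=> k; apply: (@Cn_eq _ _ _ (fun x _ => x * x ^+ n)) => //.
- exact: openT.
- by move=> x y _; rewrite exprS.
- by apply: CnM; [exact: openT|exact: Cn_fst openT|exact: IH].
Qed.

Lemma sm_swap f : sm setT f -> sm setT (fun y x => f x y).
Proof. by move=> h k; exact: (Cn_swap (h k)). Qed.

Lemma sm_is_derive1 f x y : sm setT f -> is_derive x 1 (f^~ y) (pd1 f x y).
Proof. by move=> h; exact: (Cn_is_derive1 (h 1%N)). Qed.

Lemma sm_is_derive2 f x y : sm setT f -> is_derive y 1 (f x) (pd2 f x y).
Proof. by move=> h; exact: (Cn_is_derive2 (h 1%N)). Qed.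

Lemma sm_cont f x y : sm setT f -> cont2 f x y.
Proof. by move=> h; exact: (Cn_cont (h 0%N)). Qed.

(* [I] is [P / s ^+ n.+1] where [P] is the primitive of [s ^+ n * F] vanishing
   at [s = 0], i.e. [I s t] is the integral of [u ^+ n * F (u * s) t] over
   [0 <= u <= 1].  These averages are stable under both partial derivatives. *)
Record average n (P F I : R -> R -> R) : Prop := Average {
  average_smP : sm setT P;
  average_smF : sm setT F;
  average_P0 : forall t, P 0 t = 0;
  average_dP : forall s t, pd1 P s t = s ^+ n * F s t;
  average_P : forall s t, s ^+ n.+1 * I s t = P s t;
  average_0 : forall t, I 0 t = F 0 t / n.+1%:R }.

Lemma is_derive_expr n x : is_derive x 1 (fun x : R => x ^+ n) (n%:R * x ^+ n.-1).
Proof.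
split; first exact: exprn_derivable.
by rewrite exp_derive /GRing.scale /= mulr1.
Qed.

(** Cauchy's mean value theorem for the quotient of [P] by [s ^+ n.+1], both vanishing at [s = 0];
    [h] below is the usual auxiliary function. It gives the continuity of [I] at [s = 0]. *)
Lemma average_mean n P F I s t : average n P F I ->
  exists2 c, `|c| <= `|s| & I s t = F c t / n.+1%:R.
Proof.
move=> [sP sF P0 dP PI I0]; have [->|s0] := eqVneq s 0.
  by exists 0; rewrite ?normr0.
pose h v := P v t * s ^+ n.+1 - v ^+ n.+1 * P s t.
have dh (v : R) : is_derive v 1 h (s ^+ n.+1 * (v ^+ n * F v t) - P s t * (n.+1%:R * v ^+ n)).
  have D1 : is_derive v 1 (P^~ t) (v ^+ n * F v t) by rewrite -dP; exact: sm_is_derive1.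
  have D2 := is_derive_expr n.+1 v.
  have D := is_deriveB (is_deriveM D1 (is_derive_cst (s ^+ n.+1) v 1))
    (is_deriveM D2 (is_derive_cst (P s t) v 1)).
  by apply: is_derive_eq D _; rewrite /GRing.scale /=; ring.
have [|c /andP[c1 c2]] := @mvt_between _ h _ 0 s (fun x _ => is_derive_cont (dh x)) (fun x _ => dh x).
  by rewrite eq_sym.
have c0 : c != 0 by move: c1 c2; case: (ltgtP 0 s) s0 => //; lra.
move=> E; exists c.
  by rewrite -[c]subr0 -[s]subr0; apply: btw_dist; rewrite !ltW.
have h0 : h s - h 0 = 0 by rewrite /h P0 expr0n /=; ring.
move: E; rewrite h0 subr0 => /esym/eqP.
rewrite mulf_eq0 (negbTE s0) orbF -PI => /eqP E'.
have h1 : s ^+ n.+1 * c ^+ n != 0 by rewrite mulf_neq0 ?expf_neq0.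
apply: (mulfI h1); have n0 : n.+1%:R != 0 :> R by rewrite pnatr_eq0.
apply: (mulIf n0); apply/eqP; rewrite -subr_eq0 -oppr_eq0 -E'; apply/eqP; field.
by rewrite -natr1 in n0.
Qed.

Lemma open_neq0 : open [set q : R * R | q.1 != 0].
Proof.
have -> : [set q : R * R | q.1 != 0] = fst @^-1` [set x : R | x != 0] by [].
by apply: open_comp; [move=> q _; exact: cvg_fst|exact: open_neq].
Qed.

Lemma average_off n P F I : average n P F I -> sm [set q | q.1 != 0] I.
Proof.
move=> [sP sF P0 dP PI I0] k; have oU := open_neq0.
apply: (@Cn_eq _ _ _ (fun s t => P s t * (s ^+ n.+1)^-1)) => //.
  by move=> s t /= s0; rewrite -PI; field; rewrite expf_neq0.
apply: CnM => //; first exact: (Cn_sub (@subsetT _ _) (sP k)).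
apply: CnV => //; first by move=> s t /= s0; rewrite expf_neq0.
exact: (Cn_sub (@subsetT _ _) (sm_fstX _ k)).
Qed.

Lemma average_cont n P F I s t : average n P F I -> cont2 I s t.
Proof.
move=> A; have [->|s0] := eqVneq s 0; last exact: (Cn_cont (average_off A 0%N)).
have [_ sF _ _ _ I0] := A; apply/cont2P => e e0.
have /cont2P/(_ e e0)[r r0 hr] := sm_cont 0 t sF.
exists r => // s' t' s'r t'r; have [c c1 ->] := average_mean s' t' A.
rewrite I0 -mulrBl normrM normfV; apply: le_trans (_ : e / `|n.+1%:R| <= _).
  rewrite ler_wpM2r ?invr_ge0//; apply: hr => //.
  by rewrite subr0 in s'r; rewrite subr0; exact: le_lt_trans c1 s'r.
by rewrite normr_nat ler_pdivrMr ?ltr0n//; apply: ler_peMr; [exact: ltW|rewrite ler1n].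
Qed.

(** The value at [s = 0] is the limit: [F 0 t] times the integral of [u ^+ n] over [0, 1]. *)
Definition average_of n (P F : R -> R -> R) s t :=
  if s == 0 then F 0 t / n.+1%:R else P s t / s ^+ n.+1.

Lemma average_ofP n P F : sm setT P -> sm setT F -> (forall t, P 0 t = 0) ->
  (forall s t, pd1 P s t = s ^+ n * F s t) -> average n P F (average_of n P F).
Proof.
move=> sP sF P0 dP; split=> //.
  move=> s t; rewrite /average_of; have [->|s0] := eqVneq s 0.
    by rewrite expr0n mul0r P0.
  by field; rewrite expf_neq0.
by move=> t; rewrite /average_of eqxx.
Qed.

(** Differentiation under the integral sign: the chain rule for [F (u * s) t] raises [n] by one. *)
Lemma is_derive_average1 n P F I : average n P F I ->
  exists2 P', average n.+1 P' (pd1 F) (average_of n.+1 P' (pd1 F)) &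
    forall s t, is_derive s 1 (I^~ t) (average_of n.+1 P' (pd1 F) s t).
Proof.
move=> A; have [sP sF P0 dP PI I0] := A.
(* Integration by parts gives this primitive of [s ^+ n.+1 * pd1 F s t]. *)
pose P' s t := s ^+ n.+1 * F s t + (- n.+1%:R) * P s t.
have oT := @openT (R * R)%type.
have sP' : sm setT P'.
  apply: smD oT (smM oT (sm_fstX n.+1) sF) (smM oT (sm_cst _ oT) sP).
have DP s t : is_derive s 1 (P^~ t) (s ^+ n * F s t).
  by rewrite -dP; exact: sm_is_derive1.
have A' : average n.+1 P' (pd1 F) (average_of n.+1 P' (pd1 F)).
  apply: average_ofP => //; first exact: sm_pd1.
    by move=> t; rewrite /P' P0 expr0n /= !(mul0r, mulr0) addr0.
  move=> s t; rewrite [LHS]pd1E.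
  have D2 := is_derive_expr n.+1 s.
  have D3 := sm_is_derive1 s t sF.
  have [_ E] := is_deriveD (is_deriveM D2 D3)
    (is_deriveM (is_derive_cst (- n.+1%:R : R) s 1) (DP s t)).
  by rewrite [LHS]E /GRing.scale /= exprS; ring.
exists P' => // s t.
have Doff (v : R) : v != 0 -> is_derive v 1 (I^~ t) (average_of n.+1 P' (pd1 F) v t).
  move=> v0; have dI := Cn_is_derive1 (average_off A 1%N) (v0 : [set q : R * R | q.1 != 0] (v, t)).
  have [_ E] := is_deriveM (is_derive_expr n.+1 v) dI.
  apply: is_derive_eq dI _; move: E.
  have -> : (fun x : R => x ^+ n.+1) * I^~ t = P^~ t.
    by apply/funext => w; rewrite -PI.
  have [_ ->] := DP v t; rewrite /GRing.scale /= => E.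
  rewrite /average_of (negbTE v0) /P' -PI.
  apply: (mulfI (expf_neq0 n.+2 v0)).
  rewrite [RHS]mulrCA mulfV ?expf_neq0// mulr1 exprS -mulrA.
  have -> : v ^+ n.+1 * pd1 I v t = v ^+ n * F v t - I v t * (n.+1%:R * v ^+ n).
    by rewrite E addrK.
  by rewrite [v ^+ n.+1]exprS; ring.
have [->|s0] := eqVneq s 0; last exact: Doff.
apply: (@is_derive_limit _ _ (fun s => average_of n.+1 P' (pd1 F) s t)).
- exact: cont2_1 (average_cont 0 t A).
- exact: cont2_1 (average_cont 0 t A').
- by exists 1 => // v _; exact: Doff.
Qed.

(** Here [n] is unchanged: by symmetry of the mixed derivatives, [pd2 P] is the primitive of
    [s ^+ n * pd2 F s t]. *)
Lemma is_derive_average2 n P F I : average n P F I ->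
  average n (pd2 P) (pd2 F) (average_of n (pd2 P) (pd2 F)) /\
    forall s t, is_derive t 1 (I s) (average_of n (pd2 P) (pd2 F) s t).
Proof.
move=> A; have [sP sF P0 dP PI I0] := A; have oT := @openT (R * R)%type.
split.
  apply: average_ofP; [exact: sm_pd2|exact: sm_pd2| |].
    move=> t; rewrite pd2E; have -> : P 0 = cst 0 by apply/funext.
    by rewrite derive_cst.
  move=> s t; rewrite -(schwarz oT (sP 2%N))// [LHS]pd2E.
  have -> : pd1 P s = cst (s ^+ n) * F s by apply/funext => v; rewrite dP.
  have [_ ->] := is_deriveM (is_derive_cst (s ^+ n) t 1) (sm_is_derive2 s t sF).
  by rewrite /GRing.scale /= mulr0 addr0.
move=> s t; rewrite /average_of; have [->|s0] := eqVneq s 0.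
  have -> : I 0 = F 0 * cst (n.+1%:R^-1) by apply/funext => v; rewrite I0.
  have := is_deriveM (sm_is_derive2 0 t sF) (is_derive_cst (n.+1%:R^-1 : R) t 1).
  by move/is_derive_eq; apply; rewrite /GRing.scale /= mulr0 add0r mulrC.
have -> : I s = P s * cst ((s ^+ n.+1)^-1).
  apply/funext => v; suff E : I s v = P s v * (s ^+ n.+1)^-1 by exact: E.
  by rewrite -PI; field; rewrite expf_neq0.
have := is_deriveM (sm_is_derive2 s t sP) (is_derive_cst ((s ^+ n.+1)^-1 : R) t 1).
by move/is_derive_eq; apply; rewrite /GRing.scale /= mulr0 add0r mulrC.
Qed.

Lemma average_sm n P F I : average n P F I -> sm setT I.
Proof.
move=> A k; elim: k n P F I A => [|k IH] n P F I A.
  by apply: Cn_O => s t _; exact: average_cont A.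
have [P' A1 D1] := is_derive_average1 A.
have [A2 D2] := is_derive_average2 A.
apply: (CnS (@openT _) _ (fun s t _ => D1 s t) (fun s t _ => D2 s t) (IH _ _ _ _ A1) (IH _ _ _ _ A2)).
by move=> s t _; exact: average_cont A.
Qed.

(** Since [f 0 t = 0], [f] is itself the primitive of [pd1 f], and the quotient is the average with
    [n = 0], the integral of [pd1 f (u * s) t] over 0 <= u <= 1. *)
Lemma hadamard f : sm setT f -> (forall t, f 0 t = 0) ->
  exists2 q, sm setT q & forall s t, f s t = s * q s t.
Proof.
move=> sf f0; have A : average 0 f (pd1 f) (average_of 0 f (pd1 f)).
  by apply: average_ofP => //; [exact: sm_pd1|move=> s t; rewrite mul1r].
exists (average_of 0 f (pd1 f)); first exact: average_sm A.
by move=> s t; have := average_P A s t; rewrite expr1 => <-.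
Qed.

End Hadamard.

(** * Seeley's coefficients *)

Section Seeley.
Variable R : realType.
Implicit Types (k n : nat) (b : nat -> R).

(* The Taylor coefficients of [prod_j (1 - z / 4 ^+ j)], which vanishes at every
   [z = 4 ^+ n].  Dividing the k-th one by [4 ^+ k + 1] gives an entire function
   [F] with [F (4 z) + F z] equal to this product, so [F] changes sign from
   [4 ^+ n] to [4 ^+ n.+1]. *)
Fixpoint qseq k : R :=
  if k is k'.+1 then - 4 * qseq k' / (4 ^+ k - 1) else 1.

Let pow4_gt0 k : 0 < 4 ^+ k :> R.
Proof. by rewrite exprn_gt0. Qed.

Let pow4_ge k : k.+1%:R <= 4 ^+ k.+1 - 1 :> R.
Proof.
rewrite lerBrDr natr1 -natrX ler_nat.
exact: (@ltn_expl 4 k.+1).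
Qed.

Let pow4B1_gt0 k : 0 < 4 ^+ k.+1 - 1 :> R.
Proof. by apply: lt_le_trans (pow4_ge k); rewrite ltr0n. Qed.

(** The denominators [4 ^+ k.+1 - 1] are at least [k.+1], so their product dominates the factorial.
    This is enough for all moments: weighting by [(4 ^+ k) ^+ n] only changes the argument of the
    exponential series. *)
Lemma qseq_exp k : `|qseq k| <= exp_coeff (4 : R) k.
Proof.
elim: k => [|k IH]; first by rewrite /exp_coeff /= normr1 fact0 expr0 divr1.
rewrite /= normrM normfV normrM normrN (ger0_norm (ltW (pow4B1_gt0 k))).
rewrite ler_pdivrMr//.
rewrite [`|4|]ger0_norm//.
set d := 4 ^+ k.+1 - 1; set m : R := k.+1%:R.
have m0 : m != 0 by rewrite pnatr_eq0.
have f0 : k`!%:R != 0 :> R by rewrite pnatr_eq0 -lt0n fact_gt0.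
apply: le_trans (_ : 4 * (exp_coeff (4 : R) k * (d / m)) <= _).
  rewrite ler_pM2l//; apply: le_trans IH _; apply: ler_peMr.
    exact: exp_coeff_ge0.
  by rewrite ler_pdivlMr ?ltr0n// mul1r; exact: pow4_ge.
rewrite le_eqVlt; apply/orP; left; apply/eqP.
rewrite /exp_coeff /= factS natrM exprS -/m.
by clearbody d m; field; rewrite m0 f0.
Qed.

Lemma qseq_cvg n : cvgn (series (fun k => `|qseq k| * (4 ^+ k) ^+ n)).
Proof.
apply: (@series_le_cvg _ _ (exp_coeff (4 * 4 ^+ n : R))).
- by move=> k; rewrite mulr_ge0// ltW// exprn_gt0.
- by move=> k; apply: exp_coeff_ge0; rewrite mulr_ge0// ltW.
- move=> k; apply: le_trans (ler_wpM2r _ (qseq_exp k)) _.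
    by rewrite ltW// exprn_gt0.
  by rewrite /exp_coeff /= exprMn -!exprM [(n * k)%N]mulnC mulrAC.
- exact: is_cvg_series_exp_coeff.
Qed.

Let abs_cvg b (w : nat -> R) : (forall k, `|b k| <= w k) ->
  cvgn (series w) -> cvgn (series b).
Proof.
move=> bw cw; apply: normed_cvg; apply: (series_le_cvg _ _ _ cw) => k /=; [by []| |exact: bw].
exact: le_trans (bw k).
Qed.

(** For G z = sum_k q_k z^k, the partial sums at z = 1 have the closed form q_N / 4^N, which tends
    to 0. The recursion of [qseq] says G (4 z) = (1 - 4 z) G z; its version for partial sums carries
    the zero from 4^n to 4^(n+1). *)
Lemma qseq_sum n : limn (series (fun k => qseq k * (4 ^+ k) ^+ n)) = 0.
Proof.
have cv m : cvgn (series (fun k => qseq k * (4 ^+ k) ^+ m)).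
  apply: (abs_cvg _ (@qseq_cvg m)) => k.
  by rewrite normrM [`|_ ^+ _|]ger0_norm// ltW// exprn_gt0.
elim: n => [|n IH].
  have E N : series (fun k => qseq k * (4 ^+ k) ^+ 0) N.+1 = qseq N / 4 ^+ N.
    elim: N => [|N IH].
      by rewrite /series /= big_nat1 expr0 mulr1 divr1.
    rewrite seriesSr IH expr0 mulr1 /= exprS.
    have := pow4B1_gt0 N; rewrite exprS => h.
    by field; rewrite ?gt_eqF.
  apply/cvg_lim => //; rewrite -cvg_shiftS.
  have -> : (fun N => series (fun k => qseq k * (4 ^+ k) ^+ 0) N.+1) =
      (fun N => (qseq N * (4 ^+ N) ^+ 0) * (4^-1) ^+ N).
    by apply/funext => N; rewrite E expr0 mulr1 exprVn.
  have h1 : (fun N => qseq N * (4 ^+ N) ^+ 0) @ \oo --> (0 : R).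
    exact: cvg_series_cvg_0 (cv 0%N).
  have h2 : (fun N => (4^-1 : R) ^+ N) @ \oo --> (0 : R).
    by apply: cvg_expr; rewrite ger0_norm; lra.
  by have := cvgM h1 h2; rewrite mulr0; apply.
have E N : series (fun k => qseq k * (4 ^+ k) ^+ n.+1) N.+1 =
    series (fun k => qseq k * (4 ^+ k) ^+ n) N.+1 -
    4 ^+ n.+1 * series (fun k => qseq k * (4 ^+ k) ^+ n) N.
  elim: N => [|N IHN].
    by rewrite /series /= !big_nat1 big_geq// expr0 !expr1n mulr0 subr0.
  rewrite !seriesSr in IHN *; rewrite IHN /=.
  have h : 4 ^+ N.+1 - 1 != 0 :> R by rewrite gt_eqF.
  rewrite [(4 ^+ N.+1) ^+ n.+1]exprS [4 ^+ n.+1]exprS.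
  have -> : (4 ^+ N.+1) ^+ n = 4 ^+ n * (4 ^+ N) ^+ n :> R.
    by rewrite exprS exprMn.
  by field.
apply/cvg_lim => //; rewrite -cvg_shiftS.
under eq_fun do rewrite E.
have h := cv n; rewrite IH in h.
have h' : series (fun k => qseq k * (4 ^+ k) ^+ n) N.+1 @[N --> \oo] --> (0 : R).
  by rewrite (cvg_shiftS (series _)).
have := cvgB h' (cvgM (cvg_cst (4 ^+ n.+1 : R)) h).
by rewrite mulr0 subr0; apply.
Qed.

Lemma seeley : exists a : nat -> R,
  (forall n, cvgn (series (fun k => `|a k| * (4 ^+ k) ^+ n))) /\
  (forall n, limn (series (fun k => a k * (4 ^+ k) ^+ n)) = (-1) ^+ n).
Proof.
pose b k := qseq k / (4 ^+ k + 1).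
have D0 k : 0 < 4 ^+ k + 1 :> R by rewrite addr_gt0.
have ble k : `|b k| <= `|qseq k|.
  rewrite normrM normfV (ger0_norm (ltW (D0 k))) ler_pdivrMr//.
  by apply: ler_peMr => //; rewrite lerDr ltW.
have cva n : cvgn (series (fun k => `|b k| * (4 ^+ k) ^+ n)).
  apply: (abs_cvg _ (@qseq_cvg n)) => k.
  rewrite ger0_norm; first by rewrite ler_wpM2r// ltW// exprn_gt0.
  by rewrite mulr_ge0// ltW// exprn_gt0.
have cv n : cvgn (series (fun k => b k * (4 ^+ k) ^+ n)).
  apply: (abs_cvg _ (cva n)) => k.
  by rewrite normrM [`|_ ^+ _|]ger0_norm// ltW// exprn_gt0.
pose F n := limn (series (fun k => b k * (4 ^+ k) ^+ n)).
have FS n : F n.+1 = - F n.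
  apply/eqP; rewrite -subr_eq0 opprK /F -lim_seriesD//.
  rewrite -[X in _ == X](qseq_sum n); apply/eqP; congr (limn (series _)).
  apply/funext => k.
  suff E : b k * (4 ^+ k) ^+ n.+1 + b k * (4 ^+ k) ^+ n = qseq k * (4 ^+ k) ^+ n.
    exact: E.
  have := D0 k; rewrite /b exprS; set z := 4 ^+ k; set w := z ^+ n => z0.
  by field; rewrite gt_eqF.
have F0 n : F n = (-1) ^+ n * F 0%N.
  elim: n => [|n IH]; first by rewrite mul1r.
  by rewrite FS IH exprS mulN1r mulNr.
(* Normalising requires [F 0] to be nonzero. The ratio is taken from b_1 = - 4 / 15, and the
   geometric series from k = 1 on sums to 4 / 11, less than b_0 = 1 / 2. *)
have bS k : `|b k.+1| <= (4 / 15) ^+ k.+1.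
  elim: k => [|k IH].
    have -> : b 1%N = - (4 / 15).
      by rewrite /b /= expr1; field.
    by rewrite normrN ger0_norm ?expr1//; lra.
  apply: le_trans (_ : 4 / 15 * `|b k.+1| <= _); last first.
    by rewrite [in leRHS]exprS ler_wpM2l//; lra.
  have -> : b k.+2 = - (4 * (4 ^+ k.+1 + 1) / (16 * (4 ^+ k.+1) ^+ 2 - 1)) * b k.+1.
    rewrite /b [qseq k.+2]/= -/(qseq k.+1) [4 ^+ k.+2]exprS.
    have := pow4_ge k; set z := 4 ^+ k.+1; set g := qseq k.+1.
    have k1 : 1 <= k.+1%:R :> R by rewrite ler1n.
    move=> zk; clearbody z g; have z2 : 2 <= z by lra.
    field; apply/and4P; split; apply/eqP; nra.
  rewrite normrM normrN ler_wpM2r//.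
  have z4 : 4 <= 4 ^+ k.+1 :> R.
    by rewrite exprS; apply: ler_peMr => //; rewrite exprn_ege1//; lra.
  move: z4; set z := 4 ^+ k.+1; clearbody z => z4.
  have d0 : 0 < 16 * z ^+ 2 - 1 by nra.
  rewrite ger0_norm; last by rewrite divr_ge0 ?ltW//; nra.
  by rewrite ler_pdivrMr//; nra.
have F0gt : 0 < F 0%N.
  apply: (@lt_le_trans _ _ (1 / 2 - 4 / 11)); first lra.
  (* The left-hand side is 1 / 2 minus the sum of (4 / 15)^k for 1 <= k <= N. *)
  have S_ge N : 1 / 2 - 4 / 11 + 4 / 11 * (4 / 15) ^+ N <=
      series (fun k => b k * (4 ^+ k) ^+ 0) N.+1.
    elim: N => [|N IH].
      rewrite /series /= big_nat1 (_ : b 0%N = 1 / 2) ?expr0; first lra.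
      by rewrite /b /= expr0; field.
    rewrite seriesSr expr0 mulr1.
    have := bS N; rewrite ler_norml => /andP[h _].
    move: h IH; rewrite exprS; lra.
  apply: limr_ge; first exact: cv.
  exists 1%N => // -[//|N] _ /=; apply: le_trans (S_ge N).
  by rewrite lerDl mulr_ge0 ?exprn_ge0//; lra.
exists (fun k => (F 0%N)^-1 * b k); split=> n.
  have -> : (fun k => `|(F 0%N)^-1 * b k| * (4 ^+ k) ^+ n) =
      (F 0%N)^-1 *: (fun k => `|b k| * (4 ^+ k) ^+ n).
    apply/funext => k; rewrite normrM ger0_norm ?invr_ge0 ?ltW//.
    by rewrite -mulrA.
  by apply: is_cvg_seriesZ; exact: cva.
have -> : (fun k => (F 0%N)^-1 * b k * (4 ^+ k) ^+ n) =
    (F 0%N)^-1 *: (fun k => b k * (4 ^+ k) ^+ n).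
  by apply/funext => k; rewrite -mulrA.
rewrite lim_seriesZ; last exact: cv.
by rewrite -/(F n) (F0 n) /GRing.scale /= mulrC mulfK// gt_eqF.
Qed.

End Seeley.

(** * The weighted series as a linear functional *)

Section SeeleyFunctional.
Variable R : realType.
Implicit Types (k n m : nat) (b : nat -> R) (C h : R).

(** Polynomial growth in [4 ^+ k]; differentiating a reflected series in [z] raises the degree by
    one. *)
Definition tame n C b := forall k, `|b k| <= C * (4 ^+ k) ^+ n.

Lemma pow4_ge1 k : 1 <= 4 ^+ k :> R.
Proof. by rewrite exprn_ege1//; lra. Qed.

Lemma tame_le n m C b : (n <= m)%N -> tame n C b -> tame m C b.
Proof.
move=> nm bC k; have C0 : 0 <= C.
  by have := bC 0%N; rewrite expr0 expr1n mulr1; apply: le_trans.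
by apply: le_trans (bC k) _; rewrite ler_wpM2l// ler_weXn2l// pow4_ge1.
Qed.

(* The sum of [a k * b k] for a fixed sequence [a] decreasing faster than any
   power of [4 ^+ k]. *)
Record seeley_sum (L : (nat -> R) -> R) : Prop := SeeleySum {
  seeley_sum_lin : forall n C C' C'' h b b' b'',
    tame n C b -> tame n C' b' -> tame n C'' b'' ->
    L (fun k => b k - b' k - h * b'' k) = L b - L b' - h * L b'';
  seeley_sum_bound : forall n, exists2 W, 0 <= W &
    forall C b, tame n C b -> `|L b| <= W * C;
  seeley_sum_pow : forall n, L (fun k => (4 ^+ k) ^+ n) = (-1) ^+ n }.

(** Behind [L] no series has to be handled any more. Linearity has the shape [b - b' - h * b''] of a
    first-order Taylor remainder, so that a bound on the remainders of the terms passes directly to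
    [is_derive_quad]. *)
Lemma seeley_sum_exists : exists L, seeley_sum L.
Proof.
have [a [ca sa]] := seeley R.
have can n C b : tame n C b -> cvgn (series (fun k => `|a k * b k|)).
  move=> bC; have cc := is_cvg_seriesZ (k := C) (ca n).
  apply: (series_le_cvg _ _ _ cc) => k //=.
    by apply: le_trans (_ : C * (`|a k| * (4 ^+ k) ^+ n) <= _) => //;
      rewrite mulrCA mulr_ge0// (le_trans _ (bC k)).
  rewrite normrM [leRHS](_ : _ = `|a k| * (C * (4 ^+ k) ^+ n)); last exact: mulrCA.
  by rewrite ler_wpM2l.
have cb n C b : tame n C b -> cvgn (series (fun k => a k * b k)).
  by move=> bC; apply: normed_cvg; exact: can bC.
exists (fun b => limn (series (fun k => a k * b k))); split=> //.
- move=> n C C' C'' h b b' b'' tb tb' tb''.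
  have c1 := cb _ _ _ tb; have c2 := cb _ _ _ tb'; have c3 := cb _ _ _ tb''.
  have -> : h * limn (series (fun k => a k * b'' k)) =
    limn (series (h *: (fun k => a k * b'' k))) by rewrite lim_seriesZ.
  rewrite -lim_seriesB// -lim_seriesB//; last exact: is_cvg_seriesZ.
    congr (limn (series _)); apply/funext => k.
    suff E : a k * (b k - b' k - h * b'' k) = a k * b k - a k * b' k - h * (a k * b'' k) by exact: E.
    by ring.
  exact: is_cvg_seriesB.
- move=> n; exists (limn (series (fun k => `|a k| * (4 ^+ k) ^+ n))).
    apply: limr_ge; first exact: ca.
    by apply: nearW => N; apply: sumr_ge0 => k _; rewrite mulr_ge0 ?exprn_ge0.
  move=> C b tb; apply: le_trans (lim_series_norm (can _ _ _ tb)) _.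
  rewrite mulrC -[C * _]/(C *: _) -lim_seriesZ; last exact: ca.
  apply: lim_series_le; [exact: can tb|exact: is_cvg_seriesZ (ca n)|].
  move=> k; rewrite -[leLHS]/(`|a k * b k|) normrM [leRHS](_ : _ = `|a k| * (C * (4 ^+ k) ^+ n)); last exact: mulrCA.
  by rewrite ler_wpM2l.
Qed.

End SeeleyFunctional.

(** * Even functions of the first variable *)

Section EvenFunctions.
Variable R : realType.
Implicit Types (f g : R -> R -> R) (k n m : nat) (s t x y w z h : R).

Definition even1 f := sm setT f /\ forall s t, f (- s) t = f s t.

Lemma eq_at0 (u v : R -> R) : {for 0, continuous u} -> {for 0, continuous v} ->
  (forall s, 0 < s -> u s = v s) -> u 0 = v 0.
Proof.
move=> /cont1P cu /cont1P cv uv; apply/eqP; rewrite -subr_eq0 -normr_le0.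
apply/ler_addgt0Pr => e e0; rewrite add0r.
have [|r1 r10 h1] := cu (e / 2); first by rewrite divr_gt0.
have [|r2 r20 h2] := cv (e / 2); first by rewrite divr_gt0.
have m0 : 0 < Num.min r1 r2 by rewrite lt_min r10.
have [m1 m2] : Num.min r1 r2 <= r1 /\ Num.min r1 r2 <= r2.
  by rewrite !ge_min !lexx orbT.
set s := Num.min r1 r2 / 2.
have s0 : 0 < s by rewrite divr_gt0.
have a1 : `|s - 0| < r1 by rewrite subr0 ger0_norm ?ltW//; rewrite /s; lra.
have a2 : `|s - 0| < r2 by rewrite subr0 ger0_norm ?ltW//; rewrite /s; lra.
have := h1 _ a1; have := h2 _ a2; rewrite -uv//.
rewrite !ler_norml => /andP[? ?] /andP[? ?]; apply/andP; split; lra.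
Qed.

Lemma even1_pd2 f : even1 f -> even1 (pd2 f).
Proof.
move=> [sf ef]; split; first exact: sm_pd2.
by move=> s t; rewrite !pd2E; congr ('D_1 _ t); apply/funext => v; exact: ef.
Qed.

Lemma even1_pd1 f s t : even1 f -> pd1 f (- s) t = - pd1 f s t.
Proof.
move=> [sf ef]; have D := sm_is_derive1 s t sf.
have D' := is_derive1_comp (sm_is_derive1 (- s) t sf) (is_deriveNid s 1).
have E : (f^~ t) \o -%R = f^~ t by apply/funext => v /=; rewrite ef.
rewrite E in D'; case: D => _; case: D' => _ -> <-.
by rewrite mulrN1 opprK.
Qed.

(** With w = s^2 one has d/dw = (2 s)^(-1) d/ds, so [g] represents the derivative of f (sqrt w); its
    evenness lets the construction be iterated. *)
Lemma even1_halve f : even1 f ->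
  exists2 g, even1 g & forall s t, pd1 f s t = 2 * s * g s t.
Proof.
move=> ef; have [sf _] := ef.
have d0 t : pd1 f 0 t = 0.
  by have := even1_pd1 0 t ef; rewrite oppr0 => ?; lra.
have [q sq qE] := hadamard (sm_pd1 sf) d0.
have oT := @openT (R * R)%type.
exists (fun s t => 2^-1 * q s t).
  split; first exact: smM oT (sm_cst _ oT) sq.
  move=> s t; have [->|s0] := eqVneq s 0; first by rewrite oppr0.
  have := even1_pd1 s t ef; rewrite !qE mulNr => /oppr_inj/(mulfI s0) ->.
  by [].
by move=> s t; rewrite qE; field.
Qed.

(** Compactness bounds all terms of a reflected series at once, since the square roots of the
    [rho k z] lie in [0, 1]. *)
Lemma bounded_strip f t : sm setT f ->
  exists2 C, 0 <= C & forall s t', 0 <= s <= 1 -> `|t' - t| <= 1 -> `|f s t'| <= C.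
Proof.
move=> sf; pose A := (`[0, 1]%classic `*` `[t - 1, t + 1]%classic) : set (R * R).
have A0 : A !=set0 by exists (0, t); split; rewrite /= in_itv /=; lra.
have cA : compact A by apply: compact_setX; exact: segment_compact.
have cf : {within A, continuous (fun q : R * R => `|f q.1 q.2|)}.
  apply: continuous_subspaceT => -[s t'].
  have [c] := sm_cont s t' sf.
  exact: continuous_comp c (@norm_continuous _ _ _).
have [[s0 t0] _ H] := compact_EVT_max A0 cA cf.
exists `|f s0 t0| => // s t' s01 tt.
apply: (H (s, t')); rewrite inE; split; rewrite /= in_itv //=.
by move: tt; rewrite ler_norml => /andP[? ?]; apply/andP; split; lra.
Qed.

(** As [Num.sqrt] is 0 on negative numbers, this is continuous on the whole plane; its derivative in
    [w] is computed for [0 < w]. *)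
Definition hsqrt f w t := f (Num.sqrt w) t.

Lemma hsqrt_cont f w t : sm setT f -> cont2 (hsqrt f) w t.
Proof.
move=> sf; have [c] := sm_cont (Num.sqrt w) t sf; split.
apply: (@continuous2_cvg _ _ _ _ _ _ (fun q => Num.sqrt q.1) (fun q => q.2) f _ _ c).
  apply: (@cvg_comp _ _ _ fst Num.sqrt _ (nbhs w)); first exact: cvg_fst.
  exact: sqrt_continuous.
exact: cvg_snd.
Qed.

Lemma hsqrt_derive f g w t : even1 f ->
  (forall s t, pd1 f s t = 2 * s * g s t) -> 0 < w ->
  is_derive w 1 ((hsqrt f)^~ t) (hsqrt g w t).
Proof.
move=> [sf _] fg w0.
have D := is_derive1_comp (sm_is_derive1 (Num.sqrt w) t sf) (is_derive1_sqrt w0).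
apply: is_derive_eq D _; rewrite fg /hsqrt; field.
by rewrite sqrtr_eq0 -ltNge.
Qed.

Lemma open_gt0 : open [set q : R * R | 0 < q.1].
Proof.
have -> : [set q : R * R | 0 < q.1] = fst @^-1` [set x : R | 0 < x] by [].
by apply: open_comp; [move=> q _; exact: cvg_fst|exact: open_gt].
Qed.

Lemma open_lt1 : open [set q : R * R | q.1 < 1].
Proof.
have -> : [set q : R * R | q.1 < 1] = fst @^-1` [set x : R | x < 1] by [].
by apply: open_comp; [move=> q _; exact: cvg_fst|exact: open_lt].
Qed.

Lemma hsqrt_Cn k f : even1 f -> Cn [set q | 0 < q.1] k (hsqrt f).
Proof.
elim: k f => [|k IH] f ef; have [sf _] := ef.
  by apply: Cn_O => x y _; exact: hsqrt_cont.
have [g eg fg] := even1_halve ef.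
have d1 x y : 0 < x -> is_derive x 1 ((hsqrt f)^~ y) (hsqrt g x y).
  exact: hsqrt_derive.
have d2 x y : 0 < x -> is_derive y 1 (hsqrt f x) (hsqrt (pd2 f) x y).
  by move=> _; exact: sm_is_derive2 _ _ sf.
apply: (CnS open_gt0 _ d1 d2 (IH _ eg) (IH _ (even1_pd2 ef))).
by move=> x y _; exact: hsqrt_cont.
Qed.

End EvenFunctions.

(** * Seeley's reflection *)

Section LeftBranch.
Variables (R : realType) (L : (nat -> R) -> R).
Implicit Types (f g : R -> R -> R) (k n m : nat) (s t x y w z h : R).

(** Dilation by [4 ^+ k] followed by the inverse of w / (1 - w):
    [rho k z / (1 - rho k z) = 4 ^+ k * z] for [0 <= z]. *)
Definition rho k z := 4 ^+ k * z / (1 + 4 ^+ k * z).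
Definition term f k z t := hsqrt f (rho k z) t.
(** The exponent [m] counts the differentiations in [z] already performed. *)
Definition reflected f m z t := L (fun k => (4 ^+ k) ^+ m * term f k z t).
Definition halves f g := forall s t, pd1 f s t = 2 * s * g s t.
(* The factor is [(1 - w) ^+ 2] for [w = s ^+ 2]: it accounts for the derivative
   [4 ^+ k * (1 - rho k z) ^+ 2] of [rho k]. *)
Definition damp g s t := ((1 - s * s) * (1 - s * s)) * g s t.

Let pow4_gt0 k : 0 < 4 ^+ k :> R.
Proof. by rewrite exprn_gt0. Qed.

Let den_gt0 k z : 0 <= z -> 0 < 1 + 4 ^+ k * z.
Proof. by move=> z0; rewrite ltr_pwDl// mulr_ge0// ltW. Qed.

Lemma rho_ge0 k z : 0 <= z -> 0 <= rho k z.
Proof. by move=> z0; rewrite divr_ge0 ?mulr_ge0// ltW//; exact: den_gt0. Qed.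

Lemma rho_gt0 k z : 0 < z -> 0 < rho k z.
Proof. by move=> z0; rewrite divr_gt0 ?mulr_gt0//; apply: den_gt0; exact: ltW. Qed.

Lemma rho_le1 k z : 0 <= z -> rho k z <= 1.
Proof. by move=> z0; rewrite ler_pdivrMr ?den_gt0// mul1r lerDr. Qed.

Lemma is_derive_rho k z : 0 <= z ->
  is_derive z 1 (rho k) (4 ^+ k * ((1 - rho k z) * (1 - rho k z))).
Proof.
move=> z0; have d0 := den_gt0 k z0.
have D1 : is_derive z 1 (fun z => 4 ^+ k * z) (4 ^+ k).
  have := is_deriveZ (4 ^+ k : R) (is_derive_id z 1).
  by rewrite /GRing.scale /= mulr1.
have D2 : is_derive z 1 (fun z => 1 + 4 ^+ k * z) (4 ^+ k).
  by have := is_deriveD (is_derive_cst (1 : R) z 1) D1; rewrite add0r.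
have n0 : (fun z => 1 + 4 ^+ k * z) z != 0 by rewrite gt_eqF.
have D := is_deriveM D1 (@is_deriveV R (fun z => 1 + 4 ^+ k * z) z _ _ n0 D2).
apply: is_derive_eq D _; rewrite /GRing.scale /rho /=.
by field; rewrite gt_eqF.
Qed.

Lemma term_bound f t : sm setT f ->
  exists2 C, 0 <= C &
    forall k z t', 0 <= z -> `|t' - t| <= 1 -> `|term f k z t'| <= C.
Proof.
move=> sf; have [C C0 H] := bounded_strip t sf.
exists C => // k z t' z0 tt; apply: H => //.
by rewrite sqrtr_ge0/= -sqrtr1 ler_wsqrtr// rho_le1.
Qed.

Lemma is_derive_term1 f g k z t : even1 f -> halves f g -> 0 < z ->
  is_derive z 1 ((term f k)^~ t) (4 ^+ k * term (damp g) k z t).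
Proof.
move=> ef fg z0.
have D := is_derive1_comp (hsqrt_derive t ef fg (rho_gt0 k z0)) (is_derive_rho k (ltW z0)).
have E : Num.sqrt (rho k z) * Num.sqrt (rho k z) = rho k z.
  by rewrite -expr2 sqr_sqrtr// rho_ge0// ltW.
by apply: is_derive_eq D _; rewrite /term /hsqrt /damp E; ring.
Qed.

Lemma is_derive_term2 f k z t : sm setT f ->
  is_derive t 1 (term f k z) (term (pd2 f) k z t).
Proof. by move=> sf; exact: sm_is_derive2 _ _ sf. Qed.

Lemma term_cont f k z t : sm setT f -> 0 <= z -> {for z, continuous ((term f k)^~ t)}.
Proof.
move=> sf z0.
have c1 := is_derive_cont (is_derive_rho k z0).
exact: (continuous_comp c1 (cont2_1 (hsqrt_cont (rho k z) t sf))).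
Qed.

Lemma even1_damp g : even1 g -> even1 (damp g).
Proof.
move=> [sg eg]; have oT := @openT (R * R)%type; have s1 := sm_fst oT.
have sq : sm setT (fun s _ : R => 1 - s * s).
  have -> : (fun s _ : R => 1 - s * s) = (fun s _ => 1 + -1 * (s * s)).
    by apply/funext => s; apply/funext => t; ring.
  by apply: smD oT (sm_cst _ oT) (smM oT (sm_cst _ oT) (smM oT s1 s1)).
split; first exact: smM oT (smM oT sq sq) sg.
by move=> s t; rewrite /damp eg mulrNN.
Qed.

Lemma left_tame f m z t : sm setT f -> 0 <= z ->
  exists C, forall t', `|t' - t| <= 1 ->
    tame m C (fun k => (4 ^+ k) ^+ m * term f k z t').
Proof.
move=> sf z0; have [C C0 H] := term_bound t sf.
exists C => t' tt k; rewrite normrM ger0_norm ?exprn_ge0// mulrC.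
by rewrite ler_wpM2r ?exprn_ge0//; exact: H.
Qed.

Hypothesis LP : seeley_sum L.

Lemma left_0 f m t : reflected f m 0 t = (-1) ^+ m * f 0 t.
Proof.
(* All [rho k 0] vanish, so only a moment remains; the constant [f 0 t] is pulled out through the
   available form of linearity. *)
have E : reflected f m 0 t = L (fun k => 0 - 0 - (- f 0 t) * (4 ^+ k) ^+ m).
  congr L; apply/funext => k; rewrite /term /hsqrt /rho mulr0 mul0r sqrtr0; ring.
have t0 : tame m 0 (fun=> 0 : R) by move=> k; rewrite normr0 mul0r.
have t1 : tame m 1 (fun k => (4 ^+ k) ^+ m : R).
  by move=> k; rewrite mul1r ger0_norm// exprn_ge0.
rewrite E (seeley_sum_lin LP _ t0 t0 t1) (seeley_sum_pow LP).
by ring.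
Qed.

(** The remainder of the k-th term is bounded by a multiple of 4^(2 k) h^2, the second derivative
    being expressed through [damp g2]; weights of degree [m.+2] are still summable. *)
Lemma is_derive_left1 f g m z t : even1 f -> even1 g -> halves f g -> 0 < z ->
  is_derive z 1 ((reflected f m)^~ t) (reflected (damp g) m.+1 z t).
Proof.
move=> ef eg fg z0; have edg := even1_damp eg.
have [g2 eg2 gg2] := even1_halve edg.
have [C C0 HC] := term_bound t (proj1 (even1_damp eg2)).
have [W W0 HW] := seeley_sum_bound LP m.+2.
apply: (@is_derive_quad _ _ _ _ (W * C) z) => // h hz.
have zh : 0 < z + h by move: hz; rewrite ltr_norml; lra.
have tt : `|t - t| <= 1 by rewrite subrr normr0.
(* The values have degree [m] and the derivative degree [m.+1]; linearity asks for a common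
   degree. *)
have [C1 /(_ t tt)/(tame_le (leqnSn m)) T1] := left_tame m t (proj1 ef) (ltW zh).
have [C2 /(_ t tt)/(tame_le (leqnSn m)) T2] := left_tame m t (proj1 ef) (ltW z0).
have [C3 /(_ t tt) T3] := left_tame m.+1 t (proj1 edg) (ltW z0).
rewrite /reflected -(seeley_sum_lin LP h T1 T2 T3) -mulrA; apply: HW => k.
have pos v : Num.min z (z + h) <= v <= Num.max z (z + h) -> 0 < v.
  by move=> /andP[+ _]; apply: lt_le_trans; rewrite lt_min z0.
have TB := @taylor2_bound _ ((term f k)^~ t)
  (fun v => 4 ^+ k * term (damp g) k v t)
  (fun v => 4 ^+ k * (4 ^+ k * term (damp g2) k v t)) z (z + h) ((4 ^+ k) ^+ 2 * C).
have -> : (4 ^+ k) ^+ m * term f k (z + h) t - (4 ^+ k) ^+ m * term f k z t -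
    h * ((4 ^+ k) ^+ m.+1 * term (damp g) k z t) =
  (4 ^+ k) ^+ m * (term f k (z + h) t - term f k z t -
    (z + h - z) * (4 ^+ k * term (damp g) k z t)).
  by rewrite [(4 ^+ k) ^+ m.+1]exprS; ring.
rewrite normrM [`|(4 ^+ k) ^+ m|]ger0_norm ?exprn_ge0//.
have -> : C * h ^+ 2 * (4 ^+ k) ^+ m.+2 =
    (4 ^+ k) ^+ m * ((4 ^+ k) ^+ 2 * C * (z + h - z) ^+ 2).
  by rewrite [(4 ^+ k) ^+ m.+2]exprS [(4 ^+ k) ^+ m.+1]exprS; ring.
rewrite ler_wpM2l ?exprn_ge0//; apply: TB.
- by move=> v /pos; exact: is_derive_term1.
- move=> v /pos v0; have D := is_derive_term1 k t edg gg2 v0.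
  by have := is_deriveZ (4 ^+ k : R) D; rewrite /GRing.scale /=; apply.
- move=> v /pos v0; rewrite mulrA -expr2 normrM ger0_norm ?exprn_ge0//.
  by rewrite ler_wpM2l ?exprn_ge0//; apply: HC => //; exact: ltW.
Qed.

Lemma is_derive_left2 f m z t : sm setT f -> 0 <= z ->
  is_derive t 1 (reflected f m z) (reflected (pd2 f) m z t).
Proof.
move=> sf z0; have [C C0 HC] := term_bound t (sm_pd2 (sm_pd2 sf)).
have [W W0 HW] := seeley_sum_bound LP m.
apply: (@is_derive_quad _ _ _ _ (W * C) 1) => // h h1.
have tt : `|t - t| <= 1 by rewrite subrr normr0.
have th : `|t + h - t| <= 1 by rewrite addrC addKr ltW.
have [C1 T1] := left_tame m t sf z0.
have [C3 /(_ t tt) T3] := left_tame m t (sm_pd2 sf) z0.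
rewrite /reflected -(seeley_sum_lin LP h (T1 _ th) (T1 _ tt) T3) -mulrA; apply: HW => k.
have -> : (4 ^+ k) ^+ m * term f k z (t + h) - (4 ^+ k) ^+ m * term f k z t -
    h * ((4 ^+ k) ^+ m * term (pd2 f) k z t) =
  (4 ^+ k) ^+ m * (term f k z (t + h) - term f k z t -
    (t + h - t) * (term (pd2 f) k z t)) by ring.
rewrite normrM ger0_norm ?exprn_ge0// mulrC ler_wpM2r ?exprn_ge0//.
have -> : C * h ^+ 2 = C * (t + h - t) ^+ 2 by ring.
apply: taylor2_bound.
- by move=> v _; exact: is_derive_term2.
- by move=> v _; exact: is_derive_term2 (sm_pd2 sf).
- move=> v vb; apply: HC => //; apply: le_trans (btw_dist vb) _; exact: th.
Qed.

(** Joint continuity up to [z = 0], where the derivative formulas above stop. For each term the mean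
    value theorem requires only continuity at the endpoint, and the derivative bound costs one more
    power of [4 ^+ k]. *)
Lemma left_lipschitz f m t : even1 f ->
  exists2 K, 0 <= K & forall z z' t', 0 <= z -> 0 <= z' -> `|t' - t| <= 1 ->
    `|reflected f m z' t' - reflected f m z t| <= K * (`|z' - z| + `|t' - t|).
Proof.
move=> ef; have [sf _] := ef; have [g eg fg] := even1_halve ef.
have [C1 C10 H1] := term_bound t (proj1 (even1_damp eg)).
have [C2 C20 H2] := term_bound t (sm_pd2 sf).
have [W W0 HW] := seeley_sum_bound LP m.+1.
exists (W * (C1 + C2)); first by rewrite mulr_ge0// addr_ge0.
move=> z z' t' z0 z'0 tt'.
have tt : `|t - t| <= 1 by rewrite subrr normr0.
have [D1 /(_ t' tt') T1] := left_tame m t sf z'0.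
have [D2 /(_ t tt) T2] := left_tame m t sf z0.
have T3 : tame m 0 (fun=> 0 : R) by move=> k; rewrite normr0 mul0r.
have -> : reflected f m z' t' - reflected f m z t = reflected f m z' t' - reflected f m z t - 0 * L (fun=> 0).
  by rewrite mul0r subr0.
rewrite /reflected -(seeley_sum_lin LP 0 T1 T2 T3) -mulrA; apply: HW => k.
rewrite mul0r subr0 -mulrBr normrM ger0_norm ?exprn_ge0// exprSr mulrCA.
rewrite ler_wpM2l ?exprn_ge0// [leRHS]mulrC.
have A1 : `|term f k z' t' - term f k z t'| <= 4 ^+ k * C1 * `|z' - z|.
  have [->|zz] := eqVneq z z'; first by rewrite !subrr normr0 mulr0.
  have [||c /andP[c1 _] ->] := @mvt_between _ ((term f k)^~ t')
    (fun v => 4 ^+ k * term (damp g) k v t') z z' _ _ zz.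
  - move=> v /andP[v1 _]; apply: term_cont => //.
    by apply: le_trans v1; rewrite le_min z0.
  - move=> v /andP[v1 _]; apply: is_derive_term1 => //.
    by apply: le_lt_trans v1; rewrite le_min z0.
  rewrite normrM ler_wpM2r// (normrM (4 ^+ k)) [`|4 ^+ k|]ger0_norm ?exprn_ge0//.
  rewrite ler_wpM2l ?exprn_ge0//; apply: H1 => //.
  by apply: le_trans (ltW c1); rewrite le_min z0.
have A2 : `|term f k z t' - term f k z t| <= C2 * `|t' - t|.
  have [|c cb ->] := @mvt_btw _ (term f k z) (term (pd2 f) k z) t t'.
    by move=> v _; exact: is_derive_term2.
  rewrite normrM ler_wpM2r//; apply: H2 => //.
  exact: le_trans (btw_dist cb) tt'.
rewrite -(subrK (term f k z t') (term f k z' t')) -addrA.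
apply: le_trans (ler_normD _ _) _; apply: le_trans (lerD A1 A2) _.
have p1 := pow4_ge1 R k; set p := 4 ^+ k in p1 *.
have := normr_ge0 (z' - z); have := normr_ge0 (t' - t).
move: `|t' - t| `|z' - z| => u v u0 v0.
have p0 : 0 <= p by lra.
have q0 : 0 <= p - 1 by lra.
have := mulr_ge0 p0 (mulr_ge0 C10 u0); have := mulr_ge0 p0 (mulr_ge0 C20 v0).
have := mulr_ge0 q0 (mulr_ge0 C20 u0); nra.
Qed.

End LeftBranch.

(** * Whitney's theorem on even functions *)

Section Whitney.
Variables (R : realType) (L : (nat -> R) -> R).
Hypothesis LP : seeley_sum L.
Implicit Types (f g : R -> R -> R) (k n m : nat) (s t x y w z h : R).

Lemma cont2_glue f g x t :
  (forall x t, cont2 f x t) -> (forall x t, cont2 g x t) ->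
  (forall t, f 0 t = g 0 t) ->
  cont2 (fun x t => if 0 <= x then f x t else g x t) x t.
Proof.
move=> cf cg fg; apply/cont2P => e e0.
have [r1 r10 h1] := (cont2P f x t).1 (cf x t) e e0.
have [r2 r20 h2] := (cont2P g x t).1 (cg x t) e e0.
(* A radius at most [|x|] keeps [x'] on the same side of 0 as [x]. *)
have [r r0 [rr1 rr2 rx]] : exists2 r, 0 < r & [/\ r <= r1, r <= r2 & x != 0 -> r <= `|x|].
  have [->|x0] := eqVneq x 0.
    by exists (Num.min r1 r2); rewrite ?lt_min ?r10// !ge_min !lexx orbT.
  exists (Num.min (Num.min r1 r2) `|x|); first by rewrite !lt_min r10 r20 normr_gt0.
  by rewrite !ge_min !lexx !orbT.
exists r => // x' t' xx tt.
have {}h1 := h1 _ _ (lt_le_trans xx rr1) (lt_le_trans tt rr1).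
have {}h2 := h2 _ _ (lt_le_trans xx rr2) (lt_le_trans tt rr2).
have [x0|x0|x0] := ltgtP 0 x.
- rewrite ifT//; have := rx (negbT (gt_eqF x0)); rewrite gtr0_norm// => rx'.
  by move: xx; rewrite ltr_norml; lra.
- rewrite ifF//; have := rx (negbT (lt_eqF x0)); rewrite ltr0_norm// => rx'.
  by apply/negbTE; rewrite -ltNge; move: xx; rewrite ltr_norml; lra.
- subst x; case: ifP => // _; by rewrite fg.
Qed.

(* [- x / (1 - x)] for [x <= 0], and [0] for [x >= 0].  The derivative
   [- (1 - x) ^- 2] for [x < 0] compensates [damp], so that both branches of
   [gext] below obey the same differential equation. *)
Definition zeta x := Num.max (- x) 0 / (1 + Num.max (- x) 0).

Lemma zeta_ge0 x : 0 <= zeta x.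
Proof. by rewrite /zeta divr_ge0 ?addr_ge0// le_max lexx orbT. Qed.

Lemma zeta_lipschitz x x' : `|zeta x' - zeta x| <= `|x' - x|.
Proof.
have H (a b : R) : 0 <= a -> 0 <= b -> `|a / (1 + a) - b / (1 + b)| <= `|a - b|.
  move=> a0 b0.
  have -> : a / (1 + a) - b / (1 + b) = (a - b) / ((1 + a) * (1 + b)).
    by field; apply/andP; split; apply/eqP => ?; lra.
  have p : 1 <= (1 + a) * (1 + b) by nra.
  rewrite normrM normfV ler_pdivrMr ?normr_gt0 ?gt_eqF//; last lra.
  by apply: ler_peMr => //; rewrite ger0_norm//; lra.
apply: le_trans (H _ _ _ _) _; [by rewrite le_max lexx orbT|by rewrite le_max lexx orbT|].
rewrite -[leRHS]normrN opprB.
have -> : `|x - x'| = `|(- x') - (- x)| by congr `|_|; ring.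
move: (- x') (- x) => a b.
have ab := ler_norm (a - b); have ba := ler_norm (b - a); rewrite distrC in ba.
by case: (leP a 0) => ?; case: (leP b 0) => ?; rewrite ler_norml; apply/andP; split; lra.
Qed.

Lemma zetaE x : x <= 0 -> zeta x = - x / (1 - x).
Proof. by move=> x0; rewrite /zeta max_l// oppr_ge0. Qed.

Lemma zeta0 x : 0 <= x -> zeta x = 0.
Proof. by move=> x0; rewrite /zeta max_r ?mul0r// oppr_le0. Qed.

(** The sign cancels the m-th moment, so that [gleft f m] meets [hsqrt f] at 0 for every [m]. It
    also absorbs the minus sign which the decreasing map [zeta] contributes to each derivative. *)
Definition gleft f m x t := (-1) ^+ m * reflected L f m (zeta x) t.
Definition gext f m x t := if 0 <= x then hsqrt f x t else gleft f m x t.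

Lemma gleft0 f m x t : 0 <= x -> gleft f m x t = f 0 t.
Proof.
by move=> x0; rewrite /gleft zeta0// left_0// mulrA -exprMn mulrNN mulr1 expr1n mul1r.
Qed.

Lemma gleft_cont f m x t : even1 f -> cont2 (gleft f m) x t.
Proof.
move=> ef; have [K K0 HK] := left_lipschitz LP m t ef.
apply/cont2P => e e0; have K1 : 0 < 2 * K + 1 by rewrite ltr_wpDl// mulr_ge0.
exists (Num.min 1 (e / (2 * K + 1))); first by rewrite lt_min ltr01 divr_gt0.
move=> x' t'; rewrite !lt_min => /andP[_ xx] /andP[t1 tt].
rewrite /gleft -mulrBr normrM normrX normrN1 expr1n mul1r.
apply: le_trans (HK _ _ _ (zeta_ge0 _) (zeta_ge0 _) (ltW t1)) _.
have := zeta_lipschitz x x'; move: xx tt; rewrite !ltr_pdivlMr//.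
move: `|x' - x| `|t' - t| `|_ - _| => a b c h1 h2 h3; nra.
Qed.

Lemma gext_cont f m x t : even1 f -> cont2 (gext f m) x t.
Proof.
move=> ef; apply: cont2_glue => [x' t'|x' t'|t'].
- exact: hsqrt_cont (proj1 ef).
- exact: gleft_cont.
- by rewrite gleft0// /hsqrt sqrtr0.
Qed.

Lemma gext_le0 f m x t : x <= 0 -> gext f m x t = gleft f m x t.
Proof.
move=> x0; rewrite /gext; case: ifP => // x0'.
have -> : x = 0 by apply/eqP; rewrite eq_le x0.
by rewrite gleft0// /hsqrt sqrtr0.
Qed.

Lemma is_derive_zeta x : x < 0 -> is_derive x 1 zeta (- ((1 - x)^-1 * (1 - x)^-1)).
Proof.
move=> x0.
have D1 : is_derive x 1 (fun x => 1 - x) (-1).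
  by have := is_deriveB (is_derive_cst (1 : R) x 1) (is_derive_id x 1); rewrite sub0r.
have n0 : (fun x => 1 - x) x != 0 by rewrite gt_eqF// subr_gt0; lra.
have D := is_deriveB (is_derive_cst (1 : R) x 1) (@is_deriveV R (fun x => 1 - x) x _ _ n0 D1).
have D' : is_derive x 1 (fun x => 1 - (1 - x)^-1) (- ((1 - x)^-1 * (1 - x)^-1)).
  by apply: is_derive_eq D _; rewrite /GRing.scale /=; field.
apply: near_eq_is_derive D'; near=> u.
have u0 : u < 0 by near: u; exact: lt_nbhsl.
by rewrite zetaE ?ltW//; field; rewrite gt_eqF// subr_gt0; lra.
Unshelve. all: by end_near. Qed.

(** This is d/dx = (1 - x)^(-2) d/dxi for xi = x / (1 - x). On the right the factor cancels [damp];
    on the left the sign of the derivative of [zeta] turns (-1)^m into (-1)^(m+1). At 0 the two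
    sides are joined by continuity. *)
Lemma is_derive_gext1 f g m x t : even1 f -> even1 g -> halves f g -> x < 1 ->
  is_derive x 1 ((gext f m)^~ t)
    ((1 - x)^-1 * (1 - x)^-1 * gext (damp g) m.+1 x t).
Proof.
move=> ef eg fg; have edg := even1_damp eg.
pose J x := (1 - x)^-1 * (1 - x)^-1 * gext (damp g) m.+1 x t.
have pos w : 0 < w -> w < 1 -> is_derive w 1 ((gext f m)^~ t) (J w).
  move=> w0 w1; have D := hsqrt_derive t ef fg w0.
  have -> : J w = hsqrt g w t.
    have E : Num.sqrt w * Num.sqrt w = w by rewrite -expr2 sqr_sqrtr// ltW.
    rewrite /J /gext (ltW w0) /hsqrt /damp E.
    by field; rewrite gt_eqF// subr_gt0.
  apply: near_eq_is_derive D; near=> u.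
  have u0 : 0 < u by near: u; exact: lt_nbhsr.
  by rewrite /gext (ltW u0).
have neg w : w < 0 -> is_derive w 1 ((gext f m)^~ t) (J w).
  move=> w0.
  have z0 : 0 < zeta w by rewrite zetaE ?ltW// divr_gt0; lra.
  have D := is_derive1_comp (is_derive_left1 LP m t ef eg fg z0) (is_derive_zeta w0).
  have D' := is_deriveZ ((-1) ^+ m : R) D.
  have E : J w = (-1) ^+ m *: (reflected L (damp g) m.+1 (zeta w) t * - ((1 - w)^-1 * (1 - w)^-1)).
    by rewrite /J (gext_le0 _ _ _ (ltW w0)) /gleft /GRing.scale /= exprS; ring.
  rewrite E; apply: near_eq_is_derive D'; near=> u.
  have u0 : u < 0 by near: u; exact: lt_nbhsl.
  by rewrite (gext_le0 _ _ _ (ltW u0)).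
move=> x1; have [x0|x0|x0] := ltgtP x 0; [exact: neg|exact: pos|].
rewrite x0 -/(J 0); apply: is_derive_limit.
- exact: cont2_1 (gext_cont m 0 t ef).
- have c := cont2_1 (gext_cont m.+1 0 t edg).
  have cV : {for 0, continuous (fun x : R => (1 - x)^-1)}.
    apply: cvgV; first by rewrite subr0 oner_eq0.
    by apply: cvgB; [exact: cvg_cst|exact: cvg_id].
  exact (cvgM (cvgM cV cV) c).
- exists 1 => // w; rewrite subr0 ltr_norml => /andP[_ w1] w0.
  by case: (ltgtP w 0) w0 => // w0 _; [exact: neg|exact: pos].
Unshelve. all: by end_near. Qed.

Lemma is_derive_gext2 f m x t : sm setT f ->
  is_derive t 1 (gext f m x) (gext (pd2 f) m x t).
Proof.
move=> sf; rewrite /gext; case: ifP => _; first exact: sm_is_derive2 _ _ sf.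
by have := is_deriveZ ((-1) ^+ m : R) (is_derive_left2 LP m t sf (zeta_ge0 x)); apply.
Qed.

Lemma gext_Cn k f m : even1 f -> Cn [set q | q.1 < 1] k (gext f m).
Proof.
have oU := @open_lt1 R.
have sV : sm [set q | q.1 < 1] (fun x _ : R => (1 - x)^-1).
  move=> j; apply: CnV => //; first by move=> x y /= x1; rewrite gt_eqF// subr_gt0.
  apply: (@Cn_eq _ _ _ (fun x _ : R => 1 + -1 * x)) => //.
    by move=> x y _; rewrite mulN1r.
  exact: CnD oU (Cn_cst _ _ oU) (CnM oU (Cn_cst _ _ oU) (Cn_fst _ oU)).
elim: k f m => [|k IH] f m ef.
  by apply: Cn_O => x y _; exact: gext_cont.
have [g eg fg] := even1_halve ef.
have d1 x y : x < 1 -> is_derive x 1 ((gext f m)^~ y) _ :=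
  @is_derive_gext1 f g m x y ef eg fg.
have d2 x y : x < 1 -> is_derive y 1 (gext f m x) (gext (pd2 f) m x y).
  by move=> _; exact: is_derive_gext2 _ _ _ (proj1 ef).
apply: (CnS oU _ d1 d2 _ (IH _ m (even1_pd2 ef))).
  by move=> x y _; exact: gext_cont.
exact: CnM oU (CnM oU (sV k) (sV k)) (IH _ m.+1 (even1_damp eg)).
Qed.

(** The coordinate x / (1 - x) breaks down at x = 1, but for x > 0 the function is f (sqrt x); the
    two open half-planes overlap and cover everything. *)
Lemma gext_sm f : even1 f -> sm setT (gext f 0).
Proof.
move=> ef k; have c1 := gext_Cn k 0 ef.
have c2 : Cn [set q | 0 < q.1] k (gext f 0).
  apply: Cn_eq (@open_gt0 R) _ (hsqrt_Cn k ef) => x y /= x0.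
  by rewrite /gext (ltW x0).
apply: Cn_sub (CnU c1 c2) => -[x y] _ /=.
by have [x1|x1] := ltP x 1; [left|right; lra].
Qed.

Lemma gext_sqr f m s t : even1 f -> gext f m (s * s) t = f s t.
Proof.
move=> [_ ef]; rewrite /gext -expr2 sqr_ge0 /hsqrt sqrtr_sqr.
by case: (ger0P s) => _.
Qed.

Lemma gext_even2 f m x t : (forall s t, f s (- t) = f s t) ->
  gext f m x (- t) = gext f m x t.
Proof.
move=> e2; have E s : f s (- t) = f s t by exact: e2.
rewrite /gext /hsqrt e2; case: ifP => // _; congr (_ * L _).
by apply/funext => k; rewrite /term /hsqrt e2.
Qed.

End Whitney.

(** * Functions even, or odd, in both variables *)

Section Whitney2.
Variable R : realType.
Implicit Types (f g : R -> R -> R) (s t : R).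

(** The last clause keeps evenness in [t], which permits a second application with the variables
    exchanged. *)
Lemma whitney1 f : even1 f ->
  exists g, [/\ sm setT g, forall s t, g (s * s) t = f s t &
    (forall s t, f s (- t) = f s t) -> forall s t, g s (- t) = g s t].
Proof.
move=> ef; have [L LP] := seeley_sum_exists R.
exists (gext L f 0); split.
- exact: gext_sm.
- by move=> s t; exact: gext_sqr.
- by move=> e2 s t; exact: gext_even2.
Qed.

Lemma whitney2 f : sm setT f -> (forall s t, f (- s) t = f s t) ->
  (forall s t, f s (- t) = f s t) ->
  exists2 g, sm setT g & forall s t, g (s * s) (t * t) = f s t.
Proof.
move=> sf e1 e2; have [g [sg gf ge]] := whitney1 (conj sf e1).
have eg' : even1 (fun t s => g s t) by split; [exact: sm_swap|move=> t s; exact: ge].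
have [g' [sg' gf' _]] := whitney1 eg'.
exists (fun s t => g' t s); first exact: sm_swap.
by move=> s t; rewrite gf' gf.
Qed.

(** An odd function vanishes at 0, so Hadamard's lemma divides [f] by [s] and then by [t], leaving a
    quotient even in both variables. The parities lost where one cannot cancel [s] or [t] are
    recovered by continuity. *)
Lemma whitney_odd2 f : sm setT f -> (forall s t, f (- s) t = - f s t) ->
  (forall s t, f s (- t) = - f s t) ->
  exists2 g, sm setT g & forall s t, s * t * g (s * s) (t * t) = f s t.
Proof.
move=> sf o1 o2.
have [|q sq fq] := @hadamard R f sf.
  by move=> t; have := o1 0 t; rewrite oppr0 => ?; lra.
have q2 s t : q s (- t) = - q s t.
  have H v : v != 0 -> q v (- t) = - q v t.
    by move=> v0; apply: (mulfI v0); rewrite -fq o2 fq mulrN.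
  have [->|/H//] := eqVneq s 0.
  apply: (@eq_at0 _ (q^~ (- t)) (fun v => - q v t)).
  - exact: cont2_1 (sm_cont 0 (- t) sq).
  - by apply: cvgN; exact: cont2_1 (sm_cont 0 t sq).
  - by move=> v v0; apply: H; rewrite gt_eqF.
have q1 s t : q (- s) t = q s t.
  have [->|s0] := eqVneq s 0; first by rewrite oppr0.
  by apply: (mulfI s0); apply: oppr_inj; rewrite -mulNr -!fq o1.
have [|p sp qp] := @hadamard R (fun t s => q s t) (sm_swap sq).
  by move=> s; have := q2 s 0; rewrite oppr0 => ?; lra.
have p1 t s : p (- t) s = p t s.
  have [->|t0] := eqVneq t 0; first by rewrite oppr0.
  by apply: (mulfI t0); apply: oppr_inj; rewrite -mulNr -!qp q2.
have p2 t s : p t (- s) = p t s.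
  have H v : 0 < v -> p v (- s) = p v s.
    by move=> v0; apply: (mulfI (lt0r_neq0 v0)); rewrite -!qp q1.
  have [t0|t0|->] := ltgtP t 0; last 1 first.
  - apply: (@eq_at0 _ (p^~ (- s)) (p^~ s)) H.
      exact: cont2_1 (sm_cont 0 (- s) sp).
    exact: cont2_1 (sm_cont 0 s sp).
  - by rewrite -p1 -[in RHS]p1 H// oppr_gt0.
  - exact: H.
have [g sg gp] := whitney2 (sm_swap sp) (fun s t => p2 t s) (fun s t => p1 t s).
by exists g => // s t; rewrite gp fq qp mulrA.
Qed.

End Whitney2.

(** * Functions on row vectors *)

Section Row2.
Variable R : realType.
Implicit Types (f g : R -> R -> R) (k : nat) (x y a b : R) (p u v : 'rV[R]_2).

Definition row2 x y : 'rV[R]_2 := x *: delta_mx 0 0 + y *: delta_mx 0 1.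

Lemma row2_0 x y : row2 x y 0 0 = x.
Proof. by rewrite /row2 !mxE /= mulr1 mulr0 addr0. Qed.

Lemma row2_1 x y : row2 x y 0 1 = y.
Proof. by rewrite /row2 !mxE /= mulr1 mulr0 add0r. Qed.

Lemma row2P p : row2 (p 0 0) (p 0 1) = p.
Proof.
apply/rowP => i; have : (i == 0) || (i == 1) by case: i => -[|[|]].
by case/orP => /eqP ->; rewrite (row2_0, row2_1).
Qed.

Lemma coord_le_norm v (i : 'I_2) : `|v 0 i| <= `|v|.
Proof.
rewrite {2}/Num.norm /= mx_normrE.
by apply: le_trans (le_bigmax _ (fun q : 'I_1 * 'I_2 => `|v q.1 q.2|) (0, i)).
Qed.


Definition lform a b v : R := a * v 0 0 + b * v 0 1.

Lemma lform_linear a b : linear (lform a b).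
Proof. by move=> c u v; rewrite /lform !mxE /GRing.scale /=; ring. Qed.

HB.instance Definition _ a b :=
  GRing.isLinear.Build R 'rV[R]_2 R _ (lform a b) (lform_linear a b).

Definition on_row2 f p : R := f (p 0 0) (p 0 1).

Lemma lform_continuous a b : continuous (lform a b).
Proof.
move=> v; have c i : {for v, continuous (fun w : 'rV[R]_2 => w 0 i : R)}.
  exact: coord_continuous.
exact (cvgD (cvgM (cvg_cst a) (c 0)) (cvgM (cvg_cst b) (c 1))).
Qed.

Lemma on_row2_continuous f : sm setT f -> continuous (on_row2 f).
Proof.
move=> sf p; have [c] := sm_cont (p 0 0) (p 0 1) sf.
have cc i : {for p, continuous (fun w : 'rV[R]_2 => w 0 i : R)}.
  exact: coord_continuous.
exact (continuous2_cvg _ c (cc 0) (cc 1)).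
Qed.

(** Continuous partial derivatives give differentiability: the increment is split along two
    axis-parallel segments, with a mean value on each. *)
Lemma on_row2_expansion f x y (e : R) : sm setT f -> 0 < e ->
  exists2 r, 0 < r & forall v, `|v| < r ->
    `|f (x + v 0 0) (y + v 0 1) -
      (f x y + lform (pd1 f x y) (pd2 f x y) v)| <= e * `|v|.
Proof.
move=> sf e0; rewrite /lform.
have e2 : 0 < e / 2 by rewrite divr_gt0.
have [r1 r10 h1] := (cont2P (pd1 f) x y).1 (sm_cont x y (sm_pd1 sf)) _ e2.
have [r2 r20 h2] := (cont2P (pd2 f) x y).1 (sm_cont x y (sm_pd2 sf)) _ e2.
exists (Num.min r1 r2); first by rewrite lt_min r10.
move=> v; rewrite lt_min => /andP[v1 v2].
have n0 := coord_le_norm v 0; have n1 := coord_le_norm v 1.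
have [|c cb E1] := @mvt_btw _ (f^~ (y + v 0 1)) ((pd1 f)^~ (y + v 0 1)) x (x + v 0 0).
  by move=> w _; exact: sm_is_derive1.
have [|d db E2] := @mvt_btw _ (f x) (pd2 f x) y (y + v 0 1).
  by move=> w _; exact: sm_is_derive2.
have {}cb := btw_dist cb; have {}db := btw_dist db.
have ax : x + v 0 0 - x = v 0 0 by ring.
have ay : y + v 0 1 - y = v 0 1 by ring.
rewrite ax in E1 cb; rewrite ay in E2 db.
have k1 : `|pd1 f c (y + v 0 1) - pd1 f x y| <= e / 2.
  apply: h1; first exact: le_lt_trans cb (le_lt_trans n0 v1).
  by rewrite ay; exact: le_lt_trans n1 v1.
have k2 : `|pd2 f x d - pd2 f x y| <= e / 2.
  apply: h2; first by rewrite subrr normr0.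
  exact: le_lt_trans db (le_lt_trans n1 v2).
have -> : f (x + v 0 0) (y + v 0 1) -
    (f x y + (pd1 f x y * v 0 0 + pd2 f x y * v 0 1)) =
  (pd1 f c (y + v 0 1) - pd1 f x y) * v 0 0 + (pd2 f x d - pd2 f x y) * v 0 1.
  by rewrite !mulrBl -E1 -E2; ring.
apply: le_trans (ler_normD _ _) _; rewrite !normrM.
have -> : e * `|v| = e / 2 * `|v| + e / 2 * `|v| by field.
by apply: lerD; apply: ler_pM.
Qed.

Lemma on_row2_diff f p : sm setT f -> differentiable (on_row2 f) p /\
  'd (on_row2 f) p = lform (pd1 f (p 0 0) (p 0 1)) (pd2 f (p 0 0) (p 0 1)) :> (_ -> _).
Proof.
move=> sf; set df := lform _ _.
have E : on_row2 f \o shift p = (cst (on_row2 f p) + df) +o_ (nbhs (0 : 'rV[R]_2)) id.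
  apply/eqaddoP => e e0.
  have [r r0 hr] := on_row2_expansion (p 0 0) (p 0 1) sf e0.
  apply/nbhs_ballP; exists r => // v; rewrite -ball_normE /= sub0r normrN => /hr H.
  rewrite [X in `|X| <= _](_ : _ = f (p 0 0 + v 0 0) (p 0 1 + v 0 1) -
    (f (p 0 0) (p 0 1) + df v))//.
  by rewrite [LHS]/(_ - _) /on_row2 /= !mxE ![v 0 _ + _]addrC.
have dE := diff_unique (@lform_continuous _ _) E.
split=> //; apply/diff_locallyP; rewrite dE; split=> //.
exact: lform_continuous.
Qed.

Lemma on_row2_smooth f : sm setT f -> smooth setT (on_row2 f).
Proof.
move=> sf k; elim: k f sf => [|k IH] f sf /=.
  by move=> p _; exact: on_row2_continuous.
split=> [p _|v]; first by have [] := on_row2_diff p sf.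
have oT := @openT (R * R)%type.
have -> : (fun p => 'D_v (on_row2 f) p) =
    on_row2 (fun x y => v 0 0 * pd1 f x y + v 0 1 * pd2 f x y).
  apply/funext => p; have [d dE] := on_row2_diff p sf.
  by rewrite deriveE// dE /lform /on_row2 mulrC [_ * v 0 1]mulrC.
apply: IH; apply: smD oT (smM oT (sm_cst _ oT) (sm_pd1 sf)) (smM oT (sm_cst _ oT) (sm_pd2 sf)).
Qed.

Definition map2 f g p := row2 (on_row2 f p) (on_row2 g p).

Lemma map2_diff f g p : sm setT f -> sm setT g -> differentiable (map2 f g) p /\
  forall u, 'd (map2 f g) p u =
    row2 (lform (pd1 f (p 0 0) (p 0 1)) (pd2 f (p 0 0) (p 0 1)) u)
         (lform (pd1 g (p 0 0) (p 0 1)) (pd2 g (p 0 0) (p 0 1)) u).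
Proof.
move=> sf sg; have [df dfE] := on_row2_diff p sf; have [dg dgE] := on_row2_diff p sg.
have d1 := differentiableZl (delta_mx 0 0 : 'rV[R]_2) df.
have d2 := differentiableZl (delta_mx 0 1 : 'rV[R]_2) dg.
split; first exact: differentiableD.
have E1 := diffZl (delta_mx 0 0 : 'rV[R]_2) df.
have E2 := diffZl (delta_mx 0 1 : 'rV[R]_2) dg.
move=> u; have D1 := congr1 (fun h : 'rV[R]_2 -> 'rV[R]_2 => h u) E1.
have D2 := congr1 (fun h : 'rV[R]_2 -> 'rV[R]_2 => h u) E2.
have D := congr1 (fun h : 'rV[R]_2 -> 'rV[R]_2 => h u) (diffD d1 d2).
rewrite /= in D1 D2 D; rewrite -dfE -dgE; exact (etrans D (f_equal2 +%R D1 D2)).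
Qed.

Lemma map2_smooth f g : sm setT f -> sm setT g -> smooth setT (map2 f g).
Proof.
move=> sf sg k; elim: k f g sf sg => [|k IH] f g sf sg /=.
  move=> p _; have [d _] := map2_diff p sf sg.
  exact: differentiable_continuous d.
split=> [p _|v]; first by have [] := map2_diff p sf sg.
have oT := @openT (R * R)%type.
have -> : (fun p => 'D_v (map2 f g) p) =
    map2 (fun x y => v 0 0 * pd1 f x y + v 0 1 * pd2 f x y)
         (fun x y => v 0 0 * pd1 g x y + v 0 1 * pd2 g x y).
  apply/funext => p; have [d dE] := map2_diff p sf sg.
  by rewrite deriveE// dE /lform /map2 /on_row2 ![v 0 _ * _]mulrC.
by apply: IH; apply: smD oT (smM oT (sm_cst _ oT) (sm_pd1 _))
  (smM oT (sm_cst _ oT) (sm_pd2 _)).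
Qed.

Lemma Ck_sub (E F : normedModType R) k (U V : set E) (f : E -> F) :
  U `<=` V -> Ck k V f -> Ck k U f.
Proof.
move=> UV; elim: k f => [|k IH] f /=; first by move=> H x /UV; exact: H.
by move=> [H1 H2]; split=> [x /UV|v]; [exact: H1|exact: IH].
Qed.

Lemma smooth_sub (E F : normedModType R) (U V : set E) (f : E -> F) :
  U `<=` V -> smooth V f -> smooth U f.
Proof. by move=> UV sf k; exact: Ck_sub UV (sf k). Qed.

Lemma row2_continuous : continuous (fun q : R * R => row2 q.1 q.2).
Proof.
move=> q; have h1 : (fun q : R * R => q.1) @ q --> q.1 by exact: cvg_fst.
have h2 : (fun q : R * R => q.2) @ q --> q.2 by exact: cvg_snd.
exact (cvgD (cvgZ h1 (cvg_cst (delta_mx 0 0 : 'rV[R]_2)))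
  (cvgZ h2 (cvg_cst (delta_mx 0 1 : 'rV[R]_2)))).
Qed.

Lemma is_derive_row2 (T : 'rV[R]_2 -> R^o) x y :
  differentiable T (row2 x y) ->
  is_derive x 1 (fun x => T (row2 x y) : R) ('D_(delta_mx 0 0) T (row2 x y)) /\
  is_derive y 1 (fun y => T (row2 x y) : R) ('D_(delta_mx 0 1) T (row2 x y)).
Proof.
move=> dT; split.
- have D : derivable T (row2 x y) (delta_mx 0 0) by exact: diff_derivable.
  have E : (fun h : R => h^-1 *: (((fun x => T (row2 x y)) \o shift x) (h *: (1 : R)) - T (row2 x y))) =
     (fun h : R => h^-1 *: ((T \o shift (row2 x y)) (h *: delta_mx 0 0) - T (row2 x y))).
    apply/funext => h; congr (_ *: (T _ - _)) => /=.
    rewrite (_ : h *: (1 : R) = h); last exact: mulr1.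
    by rewrite /row2 scalerDl addrA.
  by split; [rewrite /derivable E|rewrite /derive E].
- have D : derivable T (row2 x y) (delta_mx 0 1) by exact: diff_derivable.
  have E : (fun h : R => h^-1 *: (((fun y => T (row2 x y)) \o shift y) (h *: (1 : R)) - T (row2 x y))) =
     (fun h : R => h^-1 *: ((T \o shift (row2 x y)) (h *: delta_mx 0 1) - T (row2 x y))).
    apply/funext => h; congr (_ *: (T _ - _)) => /=.
    rewrite (_ : h *: (1 : R) = h); last exact: mulr1.
    by rewrite /row2 scalerDl addrCA.
  by split; [rewrite /derivable E|rewrite /derive E].
Qed.

(** Together with [on_row2_smooth], the bridge between [smooth] on row vectors and the calculus of
    [Cn] on pairs. *)
Lemma smooth_sm (T : 'rV[R]_2 -> R^o) :
  smooth setT T -> sm setT (fun x y => T (row2 x y)).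
Proof.
have cT T' x y : {for row2 x y, continuous T'} -> cont2 (fun x y => T' (row2 x y) : R) x y.
  move=> c; split.
  exact: (@continuous_comp _ _ _ (fun q : R * R => row2 q.1 q.2) T' (x, y) (@row2_continuous (x, y)) c).
move=> sT k; elim: k T sT => [|k IH] T sT.
  by apply: Cn_O => x y _; apply: cT; exact: (sT 0%N).
have dT p : differentiable T p by have [H _] := sT 1%N; exact: H.
have sD v : smooth setT (fun p => 'D_v T p) by move=> j; have [_] := sT j.+1; exact.
apply: (CnS (@openT _) _ (fun x y _ => (is_derive_row2 (dT (row2 x y))).1)
  (fun x y _ => (is_derive_row2 (dT (row2 x y))).2) (IH _ (sD _)) (IH _ (sD _))).
by move=> x y _; apply: cT; exact: differentiable_continuous.
Qed.

Lemma sm_smooth1 f c : sm setT f -> smooth setT (f c : R^o -> R^o).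
Proof.
move=> sf k; elim: k f sf => [|k IH] f sf /=.
  by move=> y _; exact: cont2_2 (sm_cont c y sf).
have dd y : derivable (f c : R^o -> R^o) y 1 by case: (sm_is_derive2 c y sf).
split=> [y _|v]; first by apply/derivable1_diffP; exact: dd.
have -> : (fun y : R^o => 'D_v (f c : R^o -> R^o) y) = (fun x y => v * pd2 f x y) c.
  apply/funext => y; rewrite deriveE; last by apply/derivable1_diffP; exact: dd.
  rewrite (deriv1E (dd y)) derive1E /GRing.scale /=; congr (_ * _).
  by case: (sm_is_derive2 c y sf).
by apply: (IH (fun x y => v * pd2 f x y)); exact: smM (@openT _) (sm_cst _ (@openT _)) (sm_pd2 sf).
Qed.

End Row2.

(** * Pullback by the squaring plot *)

Section Tensors.
Variable R : realType.
Implicit Types (f g : R -> R -> R) (x y s t : R) (p u v : 'rV[R]_2).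

Let e0 : 'rV[R]_2 := row2 1 0.
Let e1 : 'rV[R]_2 := row2 0 1.

Lemma row2_comb (a b : R) : row2 a b = a *: e0 + b *: e1.
Proof.
by rewrite /e0 /e1 /row2 !scale1r !scale0r addr0 add0r.
Qed.

Lemma sym2_expand (T : tensor2 R 2) p (a b c d : R) : smooth_sym2 setT T ->
  T p (row2 a b) (row2 c d) =
    a * c * T p e0 e0 + (a * d + b * c) * T p e0 e1 + b * d * T p e1 e1.
Proof.
move=> [lin sym _].
have scal w : scalar (T p w) by apply: lin.
have l w z z' (h k : R) : T p w (h *: z + k *: z') = h * T p w z + k * T p w z'.
  have T0 : T p w 0 = 0.
    by have := scal w (-1) 0 0; rewrite scaler0 addr0 /= => E; lra.
  by rewrite scal -[k *: z']addr0 scal T0 addr0.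
have S w z : T p w z = T p z w by exact: sym.
rewrite (row2_comb c d) (row2_comb a b) l; set A := a *: e0 + b *: e1.
by rewrite (S A e0) (S A e1) /A !(l _ e0 e1) (S e1 e0); ring.
Qed.

Lemma sym2_component_sm (T : tensor2 R 2) u v : smooth_sym2 setT T ->
  sm setT (fun x y => T (row2 x y) u v).
Proof. by move=> [_ _ sT]; exact: smooth_sm (sT u v). Qed.

Lemma pd1_cst1 (h : R -> R) (d x y : R) :
  is_derive x 1 h d -> pd1 (fun x _ => h x) x y = d.
Proof. by move=> D; rewrite pd1E; case: D. Qed.

Lemma pd2_cst1 (h : R -> R) x y : pd2 (fun x _ => h x) x y = 0.
Proof. by rewrite pd2E; exact: derive_cst. Qed.

Lemma pd2_cst2 (h : R -> R) (d x y : R) :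
  is_derive y 1 h d -> pd2 (fun _ y => h y) x y = d.
Proof. by move=> D; rewrite pd2E; case: D. Qed.

Lemma pd1_cst2 (h : R -> R) x y : pd1 (fun _ y => h y) x y = 0.
Proof. by rewrite pd1E; exact: derive_cst. Qed.

(** Squaring, the two reflections and the identity all have this form, which makes their
    differentials diagonal. *)
Definition sepmap (h k : R -> R) : 'rV[R]_2 -> 'rV[R]_2 :=
  map2 (fun x _ => h x) (fun _ y => k y).

Lemma sepmapE (h k : R -> R) x y : sepmap h k (row2 x y) = row2 (h x) (k y).
Proof. by rewrite /sepmap /map2 /on_row2 row2_0 row2_1. Qed.

Lemma sepmap_diff (h k : R -> R) (d d' x y a b : R) :
  sm setT (fun x _ : R => h x) -> sm setT (fun _ y : R => k y) ->
  is_derive x 1 h d -> is_derive y 1 k d' ->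
  'd (sepmap h k) (row2 x y) (row2 a b) = row2 (d * a) (d' * b).
Proof.
move=> sh sk D D'; have [_ ->] := map2_diff (row2 x y) sh sk.
rewrite !row2_0 !row2_1 /lform !row2_0 !row2_1 (pd1_cst1 _ D) pd2_cst1.
by rewrite (pd2_cst2 _ D') pd1_cst2 !mul0r addr0 add0r.
Qed.

Let oT := @openT (R * R)%type.

Lemma sm_id1 : sm setT (fun x _ : R => x).
Proof. exact: sm_fst oT. Qed.

Lemma sm_id2 : sm setT (fun _ y : R => y).
Proof. exact: sm_snd oT. Qed.

Lemma id_smooth : smooth setT (id : 'rV[R]_2 -> 'rV[R]_2).
Proof.
have -> : id = sepmap id id.
  by apply/funext => p; rewrite -[in RHS](row2P p) sepmapE row2P.
exact: map2_smooth sm_id1 sm_id2.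
Qed.

Definition sqmap : 'rV[R]_2 -> 'rV[R]_2 := sepmap (fun s => s * s) (fun t => t * t).

Lemma is_derive_sq (s : R) : is_derive s 1 (fun s : R => s * s) (2 * s).
Proof.
have D := is_deriveM (is_derive_id s 1) (is_derive_id s 1).
by apply: is_derive_eq D _; rewrite /GRing.scale /=; ring.
Qed.

Lemma sm_sq1 : sm setT (fun s _ : R => s * s).
Proof. exact: smM oT sm_id1 sm_id1. Qed.

Lemma sm_sq2 : sm setT (fun _ t : R => t * t).
Proof. exact: smM oT sm_id2 sm_id2. Qed.

Lemma sqmap_plot : plot (C2 (R := R)) setT sqmap.
Proof.
split; first exact: openT; first exact: map2_smooth sm_sq1 sm_sq2.
move=> p _; rewrite -(row2P p) /sqmap sepmapE.
by split; rewrite /xcoord /ycoord ?row2_0 ?row2_1 -expr2 sqr_ge0.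
Qed.

Lemma open_C2int : open (C2int (R := R)).
Proof.
have o (i : 'I_2) : open [set p : 'rV[R]_2 | 0 < p 0 i].
  have -> : [set p : 'rV[R]_2 | 0 < p 0 i] = (fun p : 'rV[R]_2 => p 0 i) @^-1` [set x : R | 0 < x] by [].
  by apply: open_comp; [move=> p _; exact: coord_continuous|exact: open_gt].
exact: openI (o 0) (o 1).
Qed.

Lemma id_plot : plot (C2 (R := R)) (C2int (R := R)) id.
Proof.
split; first exact: open_C2int.
  exact: smooth_sub (@subsetT _ _) id_smooth.
by move=> p [x0 y0]; split; exact: ltW.
Qed.

End Tensors.

Section Pullbacks.
Variables (R : realType) (tau : sym2_tensor (C2 (R := R))).
Implicit Types (x y s t : R) (p u v : 'rV[R]_2).

Let T := sym2_val tau setT (@sqmap R).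
Let TI := sym2_val tau (C2int (R := R)) id.
Let e0 : 'rV[R]_2 := row2 1 0.
Let e1 : 'rV[R]_2 := row2 0 1.

Lemma sqtensor_smooth : smooth_sym2 setT T.
Proof. exact: sym2_smooth (@sqmap_plot R). Qed.

(** If [h] and [k] preserve squares, then [sqmap] composed with [sepmap h k] is [sqmap] again, and
    compatibility with pullbacks becomes an invariance of [T]. *)
Lemma sqtensor_pullback (h k : R -> R) (d d' s t a b a' b' : R) :
  sm setT (fun x _ : R => h x) -> sm setT (fun _ y : R => k y) ->
  is_derive s 1 h d -> is_derive t 1 k d' ->
  (forall s, h s * h s = s * s) -> (forall t, k t * k t = t * t) ->
  T (row2 s t) (row2 a b) (row2 a' b') =
  T (row2 (h s) (k t)) (row2 (d * a) (d' * b)) (row2 (d * a') (d' * b')).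
Proof.
move=> sh sk D D' hh kk.
have E := @sym2_pullback _ _ _ tau _ _ _ _ setT (sepmap h k) (@sqmap R) (@sqmap_plot R)
   openT (map2_smooth sh sk) (fun _ _ => I).
rewrite /T E//; last first.
  by move=> p _; rewrite -(row2P p) /sqmap !sepmapE hh kk.
by rewrite /pullback !(sepmap_diff _ _ sh sk D D') sepmapE.
Qed.

(** The value of [tau] at [sqmap] with domain the open quadrant is computed twice: as the pullback
    by [sqmap] of the value at the inclusion, and, by locality, as the pullback of [T] by the
    identity. *)
Lemma sqtensor_interior s t a b a' b' : 0 < s -> 0 < t ->
  TI (row2 (s * s) (t * t)) (row2 (2 * s * a) (2 * t * b)) (row2 (2 * s * a') (2 * t * b')) =
  T (row2 s t) (row2 a b) (row2 a' b').
Proof.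
move=> s0 t0.
have Vp : C2int (row2 s t) by split; rewrite /xcoord /ycoord ?row2_0 ?row2_1.
have E1 := @sym2_pullback _ _ _ tau _ _ _ _ (C2int (R := R)) (@sqmap R) (@sqmap R) (@id_plot R)
   (@open_C2int R) (smooth_sub (@subsetT _ _) (map2_smooth (@sm_sq1 R) (@sm_sq2 R))).
have E2 := @sym2_pullback _ _ _ tau _ _ _ _ (C2int (R := R)) id (@sqmap R) (@sqmap_plot R)
   (@open_C2int R) (smooth_sub (@subsetT _ _) (@id_smooth R)) (fun _ _ => I) (fun _ _ => erefl) _ Vp.
have sqV p : C2int p -> C2int (sqmap p).
  rewrite -(row2P p) /sqmap sepmapE => -[]; rewrite /xcoord /ycoord !row2_0 !row2_1 => ? ?.
  by split; rewrite /xcoord /ycoord ?row2_0 ?row2_1 mulr_gt0.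
have D a1 b1 : 'd (@sqmap R) (row2 s t) (row2 a1 b1) = row2 (2 * s * a1) (2 * t * b1).
  exact: sepmap_diff _ _ (@sm_sq1 R) (@sm_sq2 R) (is_derive_sq s) (is_derive_sq t).
have E2' u v : sym2_val tau (C2int (R := R)) (@sqmap R) (row2 s t) u v = T (row2 s t) u v.
  have dI : 'd (id : 'rV[R]_2 -> 'rV[R]_2) (row2 s t) = id :> (_ -> _) by exact: diff_val.
  rewrite (E2 u v) /pullback.
  by congr (T _ _ _); rewrite dI.
have := E1 sqV (fun _ _ => erefl) _ Vp (row2 a b) (row2 a' b'); rewrite E2' => ->.
by rewrite /pullback !D /sqmap sepmapE.
Qed.

End Pullbacks.

(** * Existence and uniqueness *)

Section Existence.
Variables (R : realType) (tau : sym2_tensor (C2 (R := R))).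
Implicit Types (f : R -> R -> R) (x y s t : R) (p u v : 'rV[R]_2).

Let oT := @openT (R * R)%type.
Let e0 : 'rV[R]_2 := row2 1 0.
Let e1 : 'rV[R]_2 := row2 0 1.
Let T := sym2_val tau setT (@sqmap R).

Let is_derive_neg x : is_derive x 1 (fun x : R => -1 * x) (-1).
Proof.
have := is_deriveZ (-1 : R) (is_derive_id x 1).
by rewrite /GRing.scale /= mulr1; apply.
Qed.

Lemma sqtensor_refl1 s t a b a' b' :
  T (row2 s t) (row2 a b) (row2 a' b') =
  T (row2 (- s) t) (row2 (- a) b) (row2 (- a') b').
Proof.
have sN : sm setT (fun x _ : R => -1 * x) by exact: smM oT (sm_cst _ oT) (@sm_id1 R).
have E := sqtensor_pullback tau a b a' b' sN (@sm_id2 R) (is_derive_neg s)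
  (is_derive_id t 1) _ (fun _ => erefl).
by rewrite /T E ?mulN1r ?mul1r// => v; rewrite !mulN1r mulrNN.
Qed.

Lemma sqtensor_refl2 s t a b a' b' :
  T (row2 s t) (row2 a b) (row2 a' b') =
  T (row2 s (- t)) (row2 a (- b)) (row2 a' (- b')).
Proof.
have sN : sm setT (fun _ y : R => -1 * y) by exact: smM oT (sm_cst _ oT) (@sm_id2 R).
have E := sqtensor_pullback tau a b a' b' (@sm_id1 R) sN (is_derive_id s 1)
  (is_derive_neg t) (fun _ => erefl).
by rewrite /T E ?mulN1r ?mul1r// => v; rewrite !mulN1r mulrNN.
Qed.

Lemma sm_slice f c : sm setT f -> sm setT (fun _ y => f c y).
Proof.
move=> sf k; elim: k f sf => [|k IH] f sf.
  apply: Cn_O => x y _; apply/cont2P => e e0'.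
  have [r r0 hr] := (cont2P f c y).1 (sm_cont c y sf) e e0'.
  by exists r => // x' y' _; apply: hr; rewrite subrr normr0.
have c0 x y : cont2 (fun _ y => f c y) x y.
  apply/cont2P => e e0'; have [r r0 hr] := (cont2P f c y).1 (sm_cont c y sf) e e0'.
  by exists r => // x' y' _; apply: hr; rewrite subrr normr0.
have d1 x y : is_derive x 1 (fun=> f c y) (0 : R) by exact: is_derive_cst.
apply: (CnS oT (fun x y _ => c0 x y) (fun x y _ => d1 x y)
  (fun _ y _ => sm_is_derive2 c y sf) (Cn_cst k 0 oT) (IH _ (sm_pd2 sf))).
Qed.

Lemma split_boundary f : sm setT f ->
  exists2 q, sm setT q & forall x y, f x y = f 0 y + x * q x y.
Proof.
move=> sf; have [||q sq fq] := @hadamard R (fun x y => f x y + -1 * f 0 y).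
- exact: smD oT sf (smM oT (sm_cst _ oT) (sm_slice 0 sf)).
- by move=> t; rewrite mulN1r subrr.
- by exists q => // x y; rewrite -fq; ring.
Qed.

Lemma smooth_half_line_slice f c : sm setT f -> smooth_half_line (f c).
Proof. by move=> sf; exists (f c) => //; exact: sm_smooth1. Qed.

Lemma decomposition_exists :
  exists (sigma : tensor2 R 2) (A B : R -> R), decomposition tau sigma A B.
Proof.
have ST : smooth_sym2 setT T := sqtensor_smooth tau.
have X p a b c d := @sym2_expand R T p a b c d ST.
have R1 s t := sqtensor_refl1 s t; have R2 s t := sqtensor_refl2 s t.
(* The reflection in [s] reverses [e0] and fixes [e1]. Two occurrences of [e0], or none, give a
   component even in [s], a single one an odd component; likewise for [t] and [e1]. *)
have [a sa aE] : exists2 g, sm setT g &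
    forall s t, g (s * s) (t * t) = T (row2 s t) e0 e0.
  apply: whitney2 => [|s t|s t]; first exact: sym2_component_sm.
    by rewrite [RHS]R1 [RHS]X ?oppr0 -/e0 -/e1; ring.
  by rewrite [RHS]R2 [RHS]X ?oppr0 -/e0 -/e1; ring.
have [b sb bE] : exists2 g, sm setT g &
    forall s t, s * t * g (s * s) (t * t) = T (row2 s t) e0 e1.
  apply: whitney_odd2 => [|s t|s t]; first exact: sym2_component_sm.
    by rewrite [in RHS]R1 [in RHS]X ?oppr0 -/e0 -/e1; ring.
  by rewrite [in RHS]R2 [in RHS]X ?oppr0 -/e0 -/e1; ring.
have [c sc cE] : exists2 g, sm setT g &
    forall s t, g (s * s) (t * t) = T (row2 s t) e1 e1.
  apply: whitney2 => [|s t|s t]; first exact: sym2_component_sm.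
    by rewrite [RHS]R1 [RHS]X ?oppr0 -/e0 -/e1; ring.
  by rewrite [RHS]R2 [RHS]X ?oppr0 -/e0 -/e1; ring.
have [qa sqa qaE] := split_boundary sa.
have [qc sqc qcE] := split_boundary (sm_swap sc).
(* The factors 1 / 4 come from dx = 2 s ds and dy = 2 t dt; in the mixed term the factor s t of the
   odd component cancels as well. The arguments of [qc] are swapped because [c] is split along y =
   0. *)
pose G u v x y := (u 0 0 * v 0 0 / 4) * qa x y +
  (u 0 0 * v 0 1 + u 0 1 * v 0 0) / 4 * b x y + (u 0 1 * v 0 1 / 4) * qc y x.
pose sigma : tensor2 R 2 := fun p u v => on_row2 (G u v) p.
have sm4 g : sm setT g -> sm setT (fun x y => 4^-1 * g x y).
  by move=> sg; exact: smM oT (sm_cst _ oT) sg.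
exists sigma, (fun y => 4^-1 * a 0 y), (fun x => 4^-1 * c x 0); split.
- split.
  + by move=> p u _ k v w; rewrite /sigma /on_row2 /G !mxE; ring.
  + by move=> p u v _; rewrite /sigma /on_row2 /G; ring.
  + move=> u v; apply: (@on_row2_smooth R (G u v)).
    apply: smD oT (smD oT (smM oT (sm_cst _ oT) sqa) (smM oT (sm_cst _ oT) sb)) _.
    exact: smM oT (sm_cst _ oT) (sm_swap sqc).
- exact: (@smooth_half_line_slice (fun x y => 4^-1 * a x y) 0 (sm4 _ sa)).
- exact: (@smooth_half_line_slice (fun y x => 4^-1 * c x y) 0 (sm_swap (sm4 _ sc))).
- move=> p [x0 y0] u v.
  have dI : 'd (id : 'rV[R]_2 -> 'rV[R]_2) p = id :> (_ -> _) by exact: diff_val.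
  have -> : restriction sigma (C2int (R := R)) id p u v = sigma p u v.
    by rewrite /restriction /pullback; congr (sigma _ _ _); rewrite dI.
  pose s := Num.sqrt (xcoord p); pose t := Num.sqrt (ycoord p).
  have s0 : 0 < s by rewrite sqrtr_gt0.
  have t0 : 0 < t by rewrite sqrtr_gt0.
  have sE : xcoord p = s * s by rewrite -expr2 sqr_sqrtr// ltW.
  have tE : ycoord p = t * t by rewrite -expr2 sqr_sqrtr// ltW.
  have pE : p = row2 (s * s) (t * t) by rewrite -sE -tE row2P.
  (* Each tangent vector is written as an image under the differential of [sqmap], invertible at
     [row2 s t]. *)
  have uE (w : 'rV[R]_2) : w = row2 (2 * s * (w 0 0 / (2 * s))) (2 * t * (w 0 1 / (2 * t))).
    rewrite -[LHS](row2P w); congr (row2 _ _); field; exact: lt0r_neq0.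
  rewrite {1}pE {1}(uE u) {1}(uE v) sqtensor_interior// -/T X -aE -bE -cE.
  rewrite /sigma /on_row2 /G sE tE -[p 0 0]/(xcoord p) -[p 0 1]/(ycoord p) sE tE.
  rewrite qaE (qcE (t * t) (s * s)) /dx2 /dy2 /xcoord /ycoord.
  by field; rewrite !lt0r_neq0.
Qed.

End Existence.

Section Uniqueness.
Variables (R : realType) (tau : sym2_tensor (C2 (R := R))).
Implicit Types (f : R -> R -> R) (x y s t r : R) (p u v : 'rV[R]_2).

Let e0 : 'rV[R]_2 := row2 1 0.
Let e1 : 'rV[R]_2 := row2 0 1.

Lemma decomposition_at (sigma : tensor2 R 2) A B x y a b a' b' :
  decomposition tau sigma A B -> 0 < x -> 0 < y ->
  sym2_val tau (C2int (R := R)) id (row2 x y) (row2 a b) (row2 a' b') =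
    sigma (row2 x y) (row2 a b) (row2 a' b') + A y / x * (a * a') + B x / y * (b * b').
Proof.
move=> [_ _ _ H] x0 y0.
have V : C2int (row2 x y) by split; rewrite /xcoord /ycoord ?row2_0 ?row2_1.
rewrite H// /xcoord /ycoord /dx2 /dy2 /xcoord /ycoord !row2_0 !row2_1.
congr (_ + _ + _); rewrite /restriction /pullback.
have dI : 'd (id : 'rV[R]_2 -> 'rV[R]_2) (row2 x y) = id :> (_ -> _) by exact: diff_val.
by congr (sigma _ _ _); rewrite dI.
Qed.

Lemma half_line_eq (A A' : R -> R) : smooth_half_line A -> smooth_half_line A' ->
  (forall t, 0 < t -> A t = A' t) -> forall t, 0 <= t -> A t = A' t.
Proof.
move=> [f sf fE] [f' sf' fE'] AA t; rewrite le_eqVlt => /orP[/eqP <-|/AA//].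
rewrite fE// fE'//; apply: eq_at0.
- exact: (sf 0%N 0 I).
- exact: (sf' 0%N 0 I).
- by move=> s s0; rewrite -fE ?ltW// -fE' ?ltW// AA.
Qed.

Lemma limit_scaled f f' (A A' : R) y : sm setT f -> sm setT f' ->
  (forall x, 0 < x -> f x y + A / x = f' x y + A' / x) -> A = A'.
Proof.
move=> sf sf' H.
have c g (C : R) : sm setT g -> {for 0, continuous (fun x => x * g x y + C)}.
  move=> sg.
  have sg' : sm setT (fun x y => x * g x y + C).
    exact: smD (@openT _) (smM (@openT _) (@sm_id1 R) sg) (sm_cst _ (@openT _)).
  exact: cont2_1 (sm_cont 0 y sg').
have := @eq_at0 R (fun x => x * f x y + A) (fun x => x * f' x y + A') (c _ _ sf) (c _ _ sf').
rewrite !mul0r !add0r; apply => x x0; have := H x x0 => /(congr1 ( *%R x)).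
by rewrite !mulrDr ![x * (_ / x)]mulrC !divfK ?gt_eqF.
Qed.

Lemma decomposition_unique (sigma sigma' : tensor2 R 2) (A A' B B' : R -> R) :
  decomposition tau sigma A B -> decomposition tau sigma' A' B' ->
  [/\ eq_on_plots (C2 (R := R)) (restriction sigma) (restriction sigma'),
      forall t, 0 <= t -> A t = A' t &
      forall t, 0 <= t -> B t = B' t].
Proof.
move=> D D'; have [S sA sB _] := D; have [S' sA' sB' _] := D'.
have eA : forall t, 0 <= t -> A t = A' t.
  apply: half_line_eq => // y y0.
  apply: (limit_scaled (y := y) (sym2_component_sm e0 e0 S) (sym2_component_sm e0 e0 S')) => x x0.
  have := decomposition_at 1 0 1 0 D x0 y0; rewrite (decomposition_at 1 0 1 0 D' x0 y0).
  by rewrite !mul0r !mulr0 !mulr1 !addr0 => ->.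
have eB : forall t, 0 <= t -> B t = B' t.
  apply: half_line_eq => // x x0.
  apply: (limit_scaled (y := x) (sm_swap (sym2_component_sm e1 e1 S))
    (sm_swap (sym2_component_sm e1 e1 S'))) => y y0.
  have := decomposition_at 0 1 0 1 D x0 y0; rewrite (decomposition_at 0 1 0 1 D' x0 y0).
  by rewrite !mul0r !mulr0 !mulr1 !addr0 => ->.
split=> // m U P [_ _ PX] z Uz u v; rewrite /restriction /pullback.
(* It suffices to compare the two tensors at a point of the closed quadrant on arbitrary vectors.
   The diagonal direction leads from any such point, edges and corner included, into the interior,
   where the singular terms already agree. *)
have [p0 p1] := PX _ Uz; move: ('d P z u) ('d P z v) (P z) p0 p1 => {}u {}v p p0 p1.
have c (s : tensor2 R 2) : smooth_sym2 setT s ->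
    {for 0, continuous (fun r => s (row2 (xcoord p + r) (ycoord p + r)) u v)}.
  move=> Ss; apply/cont1P => e e0'.
  have [r r0 hr] := (cont2P _ (xcoord p) (ycoord p)).1
    (sm_cont (xcoord p) (ycoord p) (sym2_component_sm u v Ss)) e e0'.
  exists r => // w; rewrite subr0 => wr; rewrite !addr0.
  by apply: hr; rewrite addrAC subrr add0r.
have := eq_at0 (c _ S) (c _ S'); rewrite !addr0 /xcoord /ycoord row2P; apply => r r0.
have x0 : 0 < p 0 0 + r by apply: ltr_wpDl.
have y0 : 0 < p 0 1 + r by apply: ltr_wpDl.
rewrite -(row2P u) -(row2P v).
have := decomposition_at (u 0 0) (u 0 1) (v 0 0) (v 0 1) D x0 y0.
rewrite (decomposition_at _ _ _ _ D' x0 y0) (eA _ (ltW y0)) (eB _ (ltW x0)).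
by move=> /addIr/addIr.
Qed.

End Uniqueness.

Theorem theorem4p1 (R : realType) (tau : sym2_tensor (C2 (R:=R))) :
  (exists (sigma : tensor2 R 2) (A B : R -> R),
      decomposition tau sigma A B) /\
  (forall (sigma sigma' : tensor2 R 2) (A A' B B' : R -> R),
      decomposition tau sigma A B -> decomposition tau sigma' A' B' ->
      [/\ eq_on_plots (C2 (R:=R)) (restriction sigma) (restriction sigma'),
          forall t, 0 <= t -> A t = A' t &
          forall t, 0 <= t -> B t = B' t]).
Proof.
split; first exact: decomposition_exists.
by move=> sigma sigma' A A' B B'; exact: decomposition_unique.
Qed.
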